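(* Let $\bar x\in\Gamma$ be a stationary point of (P) and let MSCQ hold at $\bar x$ with modulus $\sigma>0$. Let $\kappa>0$ and suppose that $$\langle(\nabla^2 f(\bar x)+\nabla^2\langle\lambda,g\rangle(\bar x))u,u\rangle>\frac1\kappa$$ for all multipliers $\lambda\in\tilde\Lambda:=\bigcup_{v\in K_\Gamma(\bar x,-\nabla f(\bar x))\cap\mathcal S}\Lambda(\bar x,-\nabla f(\bar x);v)$ and all $u\in\mathcal S$ satisfying $\langle\lambda,\nabla g(\bar x)u\rangle=0$ and $\lambda_0\big(\|\nabla g_r(\bar x)u\|^2-(\nabla g_0(\bar x)u)^2\big)=0$. Then $\bar x$ is a tilt-stable local minimizer of (P) with modulus $\kappa$.
   Context: Setting. Let $n,m\ge1$ and let $\mathcal Q:=\{(q_0,q_r)\in\mathbb R\times\mathbb R^m:\|q_r\|\le q_0\}$ be the second-order cone. For $q=(q_0,q_r)\in\mathbb R^{1+m}$ write $\hat q:=(-q_0,q_r)$, and let $\mathcal Q^*:=\{\hat q: q\in\mathcal Q\}=\{(q_0,q_r):\|q_r\|\le-q_0\}$. The normal cone to $\mathcal Q$ at $q\in\mathcal Q$ is $N_{\mathcal Q}(q)=\mathcal Q^*$ if $q=0$, $N_{\mathcal Q}(q)=\{0\}$ if $q\in\operatorname{int}\mathcal Q$, and $N_{\mathcal Q}(q)=\{\alpha\hat q:\alpha\ge0\}$ if $q\in\operatorname{bd}\mathcal Q\setminus\{0\}$. Problem (P) is: minimize $f(x)$ subject to $x\in\Gamma:=\{x\in\mathbb R^n: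 g(x)\in\mathcal Q\}$, where $f:\mathbb R^n\to\mathbb R$ and $g=(g_0,g_r):\mathbb R^n\to\mathbb R\times\mathbb R^m$ are $C^2$-smooth around a point $\bar x\in\Gamma$ with $g(\bar x)=0$. $\nabla g(x)$ is the Jacobian, $\nabla g(x)^*$ its transpose, $\nabla^2 g(x)(u,v)\in\mathbb R^{1+m}$ is the vector with components $u^T\nabla^2 g_i(x)v$, and $\nabla^2\langle\lambda,g\rangle(x)=\sum_i\lambda_i\nabla^2 g_i(x)$. $\mathcal S$ is the unit sphere. MSCQ. The metric subregularity constraint qualification (MSCQ) holds at $\bar x$ with modulus $\sigma>0$ if there is a neighborhood $U$ of $\bar x$ with $\operatorname{dist}(x;\Gamma)\le\sigma\operatorname{dist}(g(x);\mathcal Q)$ for all $x\in U$. Multipliers and cones. $T_\Gamma(x)$ is the Bouligand tangent cone $\{v:\exists t_k\downarrow0,\ v_k\to v,\ x+t_kv_k\in\Gamma\}$. For $x\in\Gamma$, $x^*\in\mathbb R^n$: $\Lambda(x,x^* ):=\{\lambda\in N_{\mathcal Q}(g(x)):\nabla g(x)^*\lambda=x^*\}$; the critical cone is $K_\Gamma(x,x^* ):=\{u\in T_\Gamma(x):\langle x^*,u\rangle=0\}$. The curvature mapping is $\mathcal H(x,\lambda):=\frac{-\lambda_0}{g_0(x)}\big(\nabla g_r(x)^*\nabla g_r(x)-\nabla g_0(x)^*\nabla g_0(x)\big)$ if $g(x)\in\operatorname{bd}\mathcal Q\setminus\{0\}$ and $\mathcal H(x,\lambda):=0$ otherwise. The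 directional multiplier set is $\Lambda(x,x^*;u):=\operatorname{argmax}_{\lambda\in\Lambda(x,x^* )}\langle(\nabla^2\langle\lambda,g\rangle(x)+\mathcal H(x,\lambda))u,u\rangle$. Stationarity and tilt stability. $\bar x$ is a stationary point of (P) if $-\nabla f(\bar x)\in N_\Gamma(\bar x)$, where $N_\Gamma$ is the limiting (Mordukhovich) normal cone. Let $\varphi:=f+\delta_\Gamma$ ($\delta_\Gamma$ the indicator function of $\Gamma$). $\bar x$ is a tilt-stable local minimizer of (P) with modulus $\kappa>0$ if there is $\gamma>0$ such that $M_\gamma(v^* ):=\operatorname{argmin}\{\varphi(x)-\langle v^*,x\rangle:\|x-\bar x\|\le\gamma\}$ is single-valued and Lipschitz continuous with constant $\kappa$ on a neighborhood of $0$, with $M_\gamma(0)=\{\bar x\}$. *)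

(* Defs.v *)
From Stdlib Require Import Reals Lra.
From Stdlib Require Vectors.Fin.
From Stdlib Require Import ClassicalEpsilon.
Open Scope R_scope.

Definition vec (n : nat) := Fin.t n -> R.
Definition mat (n : nat) := Fin.t n -> Fin.t n -> R.

Fixpoint sumF (n : nat) : (Fin.t n -> R) -> R :=
  match n return (Fin.t n -> R) -> R with
  | O => fun _ => 0
  | S k => fun x => x Fin.F1 + sumF k (fun i => x (Fin.FS i))
  end.

Definition vadd {n} (x y : vec n) : vec n := fun i => x i + y i.
Definition vsub {n} (x y : vec n) : vec n := fun i => x i - y i.
Definition vscale {n} (a : R) (x : vec n) : vec n := fun i => a * x i.
Definition vopp {n} (x : vec n) : vec n := fun i => - x i.
Definition vzero {n} : vec n := fun _ => 0.
Definition dot {n} (x y : vec n) : R := sumF n (fun i => x i * y i).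
Definition norm {n} (x : vec n) : R := sqrt (dot x x).
Definition matvec {n} (A : mat n) (u : vec n) : vec n := fun i => dot (A i) u.
Definition madd {n} (A B : mat n) : mat n := fun i j => A i j + B i j.
Definition quad {n} (A : mat n) (u : vec n) : R := dot (matvec A u) u.

Definition vcv {n} (xk : nat -> vec n) (x : vec n) : Prop :=
  Un_cv (fun k => norm (vsub (xk k) x)) 0.

Definition frechet_grad {n} (h : vec n -> R) (x v : vec n) : Prop :=
  forall eps, 0 < eps -> exists d, 0 < d /\ forall y, norm (vsub y x) < d ->
    Rabs (h y - h x - dot v (vsub y x)) <= eps * norm (vsub y x).

Definition frechet_jac {n} (G : vec n -> vec n) (x : vec n) (H : mat n) : Prop :=
  forall eps, 0 < eps -> exists d, 0 < d /\ forall y, norm (vsub y x) < d ->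
    norm (vsub (vsub (G y) (G x)) (matvec H (vsub y x))) <= eps * norm (vsub y x).

Definition mat_cont_at {n} (H : vec n -> mat n) (x : vec n) : Prop :=
  forall i j eps, 0 < eps -> exists d, 0 < d /\ forall y, norm (vsub y x) < d ->
    Rabs (H y i j - H x i j) < eps.

Definition C2_near {n} (h : vec n -> R) (dh : vec n -> vec n) (d2h : vec n -> mat n)
    (xbar : vec n) : Prop :=
  exists r, 0 < r /\ forall x, norm (vsub x xbar) < r ->
    frechet_grad h x (dh x) /\ frechet_jac dh x (d2h x) /\ mat_cont_at d2h x.

Definition inQ {m} (q : R * vec m) : Prop := norm (snd q) <= fst q.
Definition hatq {m} (q : R * vec m) : R * vec m := (- fst q, snd q).
Definition qzero {m} : R * vec m := (0, vzero).
Definition inQstar {m} (q : R * vec m) : Prop := exists p, inQ p /\ q = hatq p.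
Definition psub {m} (a b : R * vec m) : R * vec m := (fst a - fst b, vsub (snd a) (snd b)).
Definition pnorm {m} (a : R * vec m) : R := sqrt (fst a * fst a + dot (snd a) (snd a)).
Definition pdot {m} (a b : R * vec m) : R := fst a * fst b + dot (snd a) (snd b).

Definition NQ {m} (q l : R * vec m) : Prop :=
  (q = qzero /\ inQstar l)
  \/ (norm (snd q) < fst q /\ l = qzero)
  \/ (norm (snd q) = fst q /\ q <> qzero /\ exists a, 0 <= a /\ l = (a * fst (hatq q), vscale a (snd q))).

Definition bdQ_nonzero {m} (q : R * vec m) : Prop := norm (snd q) = fst q /\ q <> qzero.

(** Jacobian of g = (g0, gr) given by the gradient of g0 (Jg0) and of each gr_i (Jgr i). *)
Definition Jg_apply {n m} (Jg0 : vec n) (Jgr : Fin.t m -> vec n) (u : vec n) : R * vec m :=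
  (dot Jg0 u, fun i => dot (Jgr i) u).
Definition Jg_adj {n m} (Jg0 : vec n) (Jgr : Fin.t m -> vec n) (l : R * vec m) : vec n :=
  fun j => fst l * Jg0 j + sumF m (fun i => snd l i * Jgr i j).
Definition hess_lag {n m} (H0 : mat n) (Hr : Fin.t m -> mat n) (l : R * vec m) : mat n :=
  fun i j => fst l * H0 i j + sumF m (fun k => snd l k * Hr k i j).

(** Curvature mapping H(x, lambda), given gx = g(x) and the Jacobian data at x. *)
Definition curv {n m} (gx : R * vec m) (Jg0 : vec n) (Jgr : Fin.t m -> vec n)
    (l : R * vec m) : mat n :=
  if excluded_middle_informative (bdQ_nonzero gx)
  then fun i j => (- fst l / fst gx) *
         (sumF m (fun k => Jgr k i * Jgr k j) - Jg0 i * Jg0 j)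
  else fun _ _ => 0.

Definition Lambda {n m} (gx : R * vec m) (Jg0 : vec n) (Jgr : Fin.t m -> vec n)
    (xs : vec n) (l : R * vec m) : Prop :=
  NQ gx l /\ Jg_adj Jg0 Jgr l = xs.

Definition DirLambda {n m} (gx : R * vec m) (Jg0 : vec n) (Jgr : Fin.t m -> vec n)
    (H0 : mat n) (Hr : Fin.t m -> mat n) (xs u : vec n) (l : R * vec m) : Prop :=
  Lambda gx Jg0 Jgr xs l /\
  forall mu, Lambda gx Jg0 Jgr xs mu ->
    quad (madd (hess_lag H0 Hr mu) (curv gx Jg0 Jgr mu)) u
      <= quad (madd (hess_lag H0 Hr l) (curv gx Jg0 Jgr l)) u.

Definition Gamma {n m} (g : vec n -> R * vec m) (x : vec n) : Prop := inQ (g x).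

Definition tangent {n} (S : vec n -> Prop) (x v : vec n) : Prop :=
  exists (t : nat -> R) (vk : nat -> vec n),
    (forall k, 0 < t k) /\ Un_cv t 0 /\ vcv vk v /\
    forall k, S (vadd x (vscale (t k) (vk k))).

Definition critical {n} (S : vec n -> Prop) (x xs u : vec n) : Prop :=
  tangent S x u /\ dot xs u = 0.

Definition frechet_normal {n} (S : vec n -> Prop) (x v : vec n) : Prop :=
  S x /\ forall eps, 0 < eps -> exists d, 0 < d /\ forall y, S y ->
    norm (vsub y x) < d -> dot v (vsub y x) <= eps * norm (vsub y x).
Definition limiting_normal {n} (S : vec n -> Prop) (x v : vec n) : Prop :=
  exists (xk vk : nat -> vec n),
    (forall k, S (xk k)) /\ vcv xk x /\ vcv vk v /\
    forall k, frechet_normal S (xk k) (vk k).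

Definition is_inf (A : R -> Prop) (a : R) : Prop :=
  (forall s, A s -> a <= s) /\ (forall w, (forall s, A s -> w <= s) -> w <= a).

Definition MSCQ {n m} (g : vec n -> R * vec m) (xbar : vec n) (sigma : R) : Prop :=
  exists r, 0 < r /\ forall x, norm (vsub x xbar) < r ->
    forall dG dQ,
      is_inf (fun s => exists y, Gamma g y /\ s = norm (vsub x y)) dG ->
      is_inf (fun s => exists q, inQ q /\ s = pnorm (psub (g x) q)) dQ ->
      dG <= sigma * dQ.

Definition Mgamma {n} (f : vec n -> R) (S : vec n -> Prop) (xbar : vec n) (gamma : R)
    (vs x : vec n) : Prop :=
  S x /\ norm (vsub x xbar) <= gamma /\
  forall y, S y -> norm (vsub y xbar) <= gamma -> f x - dot vs x <= f y - dot vs y.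

Definition tilt_stable {n} (f : vec n -> R) (S : vec n -> Prop) (xbar : vec n) (kappa : R) : Prop :=
  exists gamma, 0 < gamma /\
    (exists eps, 0 < eps /\
       (forall vs, norm vs < eps -> exists x, Mgamma f S xbar gamma vs x /\
            forall y, Mgamma f S xbar gamma vs y -> y = x) /\
       (forall v1 v2 x1 x2, norm v1 < eps -> norm v2 < eps ->
            Mgamma f S xbar gamma v1 x1 -> Mgamma f S xbar gamma v2 x2 ->
            norm (vsub x1 x2) <= kappa * norm (vsub v1 v2))) /\
    (forall x, Mgamma f S xbar gamma vzero x <-> x = xbar).

(* Main.v *)
(** Tilt stability is deduced from the growth estimate
    [f x - <v,x> + |y - x|^2/(2 kappa) <= f y - <v,y>] for feasible [y] near [xbar] and stationary
    points [x <> xbar] of the problem tilted by [v], both near [xbar]. If it failed along a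
    sequence, metric subregularity would give multipliers [l_k] at [x_k] with
    [|l_k| <= 2 sigma |v_k - df x_k|]. A limit [l] of them is a directional multiplier for the
    critical direction [lim (x_k - xbar)/|x_k - xbar|]: any better multiplier would be parallel
    to [l], forcing [df xbar = 0] and hence [l = 0] by the bound. A limit [u] of
    [(y_k - x_k)/|y_k - x_k|] satisfies the two side conditions because [-<l_k, g y_k>] is
    [O(|y_k - x_k|^2)], and a second-order expansion of the Lagrangian contradicts the second-order
    condition at [(l, u)]. Strict local minimality of [xbar] is obtained in the same way from
    auxiliary stationary points. The Lipschitz estimate between two minimizers different from
    [xbar] follows by adding two growth inequalities; if one of them is [xbar], the estimate
    is carried along the segment joining the tilts up to the first point where [xbar] becomes
    optimal. *)

From Stdlib Require Import Reals Lra Lia FunctionalExtensionality ClassicalEpsilon Classical.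
From Stdlib Require Vectors.Fin.
From Coquelicot Require Import Coquelicot.
Require Import Defs.
Open Scope R_scope.

(** * Sums, scalar products and norms *)

(** The second-order condition constrains only multipliers that are maximal in some critical
    direction, and a given multiplier at [xbar] need not be of this kind. Limits of multipliers at
    points [x_k <> xbar] are, because complementarity at [x_k] ties them to the direction of
    approach. This is why the growth estimate excludes [x = xbar], and why minimality and the
    Lipschitz estimate at [xbar] need arguments of their own. The multiplier set at [xbar] may be
    unbounded, so compactness has to come from the bound by [2 sigma]. It is obtained from a
    quadratic penalty: the factor 2 appears when [K/2 D^2] is compared with a term linear in the
    residual [D]. The estimate of [-<l_k, g y_k>] is a sandwich: polarity makes it nonnegative,
    violated growth bounds it above. Divided by [|y_k - x_k|] it gives the first side condition. For
    the second, an inequality on the cone bounds [l_0] times the Lorentz form of [g y_k - g x_k] by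
    [-<l_k, g y_k>] times the heads of [g y_k] and [g x_k], and these heads tend to 0 because
    [g xbar = 0]. *)

Lemma sumF_ext n (x y : vec n) : (forall i, x i = y i) -> sumF n x = sumF n y.
Proof.
  intro H; f_equal; apply functional_extensionality; exact H.
Qed.

Lemma sumF_zero n : sumF n (fun _ => 0) = 0.
Proof. induction n as [|n IH]; simpl; [|rewrite IH]; lra. Qed.

Lemma sumF_plus n (x y : vec n) : sumF n (fun i => x i + y i) = sumF n x + sumF n y.
Proof.
  induction n as [|n IH]; simpl; [lra|].
  rewrite (IH (fun i => x (Fin.FS i)) (fun i => y (Fin.FS i))); lra.
Qed.

Lemma sumF_scal n a (x : vec n) : sumF n (fun i => a * x i) = a * sumF n x.
Proof.
  induction n as [|n IH]; simpl; [lra|].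
  rewrite (IH (fun i => x (Fin.FS i))); lra.
Qed.

Lemma sumF_exchange n m (A : Fin.t n -> Fin.t m -> R) :
  sumF n (fun i => sumF m (fun j => A i j)) = sumF m (fun j => sumF n (fun i => A i j)).
Proof.
  induction n as [|n IH]; simpl.
  - now rewrite sumF_zero.
  - rewrite (IH (fun i j => A (Fin.FS i) j)), <- sumF_plus; reflexivity.
Qed.

Lemma sumF_le n (x y : vec n) : (forall i, x i <= y i) -> sumF n x <= sumF n y.
Proof.
  induction n as [|n IH]; simpl; intro H; [lra|].
  apply Rplus_le_compat; [apply H|apply IH; intro; apply H].
Qed.

Lemma sumF_nonneg n (x : vec n) : (forall i, 0 <= x i) -> 0 <= sumF n x.
Proof. intro H; rewrite <- (sumF_zero n); apply sumF_le; exact H. Qed.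

Lemma sumF_term_le n (x : vec n) i : (forall j, 0 <= x j) -> x i <= sumF n x.
Proof.
  revert x; induction i as [n|n i IH]; simpl; intros x H.
  - assert (0 <= sumF n (fun j => x (Fin.FS j))) by (apply sumF_nonneg; intro; apply H); lra.
  - specialize (IH (fun j => x (Fin.FS j)) (fun j => H _)); simpl in IH.
    specialize (H Fin.F1); lra.
Qed.

Lemma dot_comm n (x y : vec n) : dot x y = dot y x.
Proof. apply sumF_ext; intro; ring. Qed.

Lemma dot_add_l n (x y z : vec n) : dot (vadd x y) z = dot x z + dot y z.
Proof. unfold dot; rewrite <- sumF_plus; apply sumF_ext; intro; unfold vadd; ring. Qed.

Lemma dot_scale_l n a (x y : vec n) : dot (vscale a x) y = a * dot x y.
Proof. unfold dot; rewrite <- sumF_scal; apply sumF_ext; intro; unfold vscale; ring. Qed.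

Lemma dot_sub_l n (x y z : vec n) : dot (vsub x y) z = dot x z - dot y z.
Proof.
  replace (vsub x y) with (vadd x (vscale (-1) y))
    by (apply functional_extensionality; intro; unfold vadd, vscale, vsub; ring).
  rewrite dot_add_l, dot_scale_l; ring.
Qed.

Lemma dot_opp_l n (x y : vec n) : dot (vopp x) y = - dot x y.
Proof.
  replace (vopp x) with (vscale (-1) x)
    by (apply functional_extensionality; intro; unfold vscale, vopp; ring).
  rewrite dot_scale_l; ring.
Qed.

Lemma dot_zero_l n (x : vec n) : dot vzero x = 0.
Proof.
  unfold dot; rewrite <- (sumF_zero n); apply sumF_ext; intro; unfold vzero; ring.
Qed.

Lemma dot_add_r n (x y z : vec n) : dot z (vadd x y) = dot z x + dot z y.
Proof. rewrite dot_comm, dot_add_l, !(dot_comm _ z); ring. Qed.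

Lemma dot_sub_r n (x y z : vec n) : dot z (vsub x y) = dot z x - dot z y.
Proof. rewrite dot_comm, dot_sub_l, !(dot_comm _ z); ring. Qed.

Lemma dot_scale_r n a (x y : vec n) : dot x (vscale a y) = a * dot x y.
Proof. rewrite dot_comm, dot_scale_l, dot_comm; ring. Qed.

Lemma dot_zero_r n (x : vec n) : dot x vzero = 0.
Proof. rewrite dot_comm; apply dot_zero_l. Qed.

Lemma dot_self_nonneg n (x : vec n) : 0 <= dot x x.
Proof. apply sumF_nonneg; intro; nra. Qed.

Lemma sq_comp_le n (x : vec n) i : x i * x i <= dot x x.
Proof. apply (sumF_term_le n (fun j => x j * x j)); intro; nra. Qed.

Lemma dot_self_eq0 n (x : vec n) : dot x x = 0 -> x = vzero.
Proof.
  intro H; apply functional_extensionality; intro i.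
  pose proof (sq_comp_le n x i); unfold vzero; nra.
Qed.

Lemma norm_nonneg n (x : vec n) : 0 <= norm x.
Proof. apply sqrt_pos. Qed.

Lemma norm_sq n (x : vec n) : norm x * norm x = dot x x.
Proof. apply sqrt_sqrt, dot_self_nonneg. Qed.

Lemma norm_eq0 n (x : vec n) : norm x = 0 -> x = vzero.
Proof. intro H; apply dot_self_eq0; rewrite <- norm_sq, H; ring. Qed.

Lemma norm_zero n : norm (@vzero n) = 0.
Proof. unfold norm; rewrite dot_zero_l; apply sqrt_0. Qed.

Lemma cauchy_schwarz n (x y : vec n) : Rabs (dot x y) <= norm x * norm y.
Proof.
  assert (H : dot x y * dot x y <= dot x x * dot y y).
  { destruct (Req_dec (dot y y) 0) as [E|E].
    - rewrite (dot_self_eq0 _ _ E), !dot_zero_r; lra.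
    (* This square equals [<y,y> (<x,x><y,y> - <x,y>^2)]. *)
    - pose proof (dot_self_nonneg n (vsub (vscale (dot y y) x) (vscale (dot x y) y))) as P.
      rewrite dot_sub_l, !dot_sub_r, !dot_scale_l, !dot_scale_r, (dot_comm _ y x) in P.
      pose proof (dot_self_nonneg n y).
      nra. }
  rewrite <- !norm_sq in H.
  pose proof (norm_nonneg n x); pose proof (norm_nonneg n y).
  assert (0 <= norm x * norm y) by nra.
  apply Rabs_le; split; nra.
Qed.

Lemma dot_le_norm n (x y : vec n) : dot x y <= norm x * norm y.
Proof. eapply Rle_trans; [apply Rle_abs|apply cauchy_schwarz]. Qed.

Lemma norm_le_sq n (x : vec n) a : 0 <= a -> dot x x <= a * a -> norm x <= a.
Proof. intros Ha H; rewrite <- norm_sq in H; pose proof (norm_nonneg n x); nra. Qed.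

Lemma norm_add n (x y : vec n) : norm (vadd x y) <= norm x + norm y.
Proof.
  pose proof (norm_nonneg n x); pose proof (norm_nonneg n y).
  apply norm_le_sq; [lra|].
  rewrite dot_add_l, !dot_add_r, (dot_comm _ y x).
  pose proof (dot_le_norm n x y); pose proof (norm_sq n x); pose proof (norm_sq n y); nra.
Qed.

Lemma norm_scale n a (x : vec n) : norm (vscale a x) = Rabs a * norm x.
Proof.
  unfold norm; rewrite dot_scale_l, dot_scale_r, <- Rmult_assoc, sqrt_mult_alt by nra.
  now rewrite <- (sqrt_Rsqr_abs a).
Qed.

Lemma norm_opp n (x : vec n) : norm (vopp x) = norm x.
Proof.
  unfold norm; f_equal; rewrite dot_opp_l, dot_comm, dot_opp_l; ring.
Qed.

Lemma norm_vsub_sym n (x y : vec n) : norm (vsub x y) = norm (vsub y x).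
Proof.
  rewrite <- norm_opp; f_equal; apply functional_extensionality; intro.
  unfold vopp, vsub; ring.
Qed.

Lemma norm_vsub_triangle n (x y z : vec n) :
  norm (vsub x z) <= norm (vsub x y) + norm (vsub y z).
Proof.
  replace (vsub x z) with (vadd (vsub x y) (vsub y z))
    by (apply functional_extensionality; intro; unfold vadd, vsub; ring).
  apply norm_add.
Qed.

Lemma vsub_diag n (x : vec n) : vsub x x = vzero.
Proof. apply functional_extensionality; intro; unfold vsub, vzero; ring. Qed.

Lemma norm_vsub_diag n (x : vec n) : norm (vsub x x) = 0.
Proof. rewrite vsub_diag; apply norm_zero. Qed.

Lemma norm_vsub_eq0 n (x y : vec n) : norm (vsub x y) = 0 -> x = y.
Proof.
  intro H; apply norm_eq0 in H; apply functional_extensionality; intro i.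
  apply (f_equal (fun v => v i)) in H; unfold vsub, vzero in H; lra.
Qed.

Lemma norm_vsub_pos n (x y : vec n) : x <> y -> 0 < norm (vsub x y).
Proof.
  intro H; destruct (norm_nonneg n (vsub x y)) as [L|L]; [exact L|].
  exfalso; apply H, norm_vsub_eq0; congruence.
Qed.

Lemma abs_comp_le_norm n (x : vec n) i : Rabs (x i) <= norm x.
Proof.
  pose proof (sq_comp_le n x i) as H; rewrite <- norm_sq in H.
  pose proof (norm_nonneg n x); apply Rabs_le; split; nra.
Qed.

Lemma norm_normalized n (x : vec n) : 0 < norm x -> norm (vscale (/ norm x) x) = 1.
Proof.
  intro H; rewrite norm_scale, Rabs_right.
  - field; lra.
  - apply Rle_ge, Rlt_le, Rinv_0_lt_compat, H.
Qed.

Lemma vsub_vadd n (x d : vec n) : vsub (vadd x d) x = d.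
Proof. apply functional_extensionality; intro; unfold vadd, vsub; ring. Qed.

(** * Convergence *)

(** Componentwise form of [vcv] (see [vcv_vlim]): limits of scalar products, adjoints and quadratic
    forms reduce to sums and products of real limits. *)
Definition vlim {n} (x : nat -> vec n) (l : vec n) : Prop :=
  forall i, is_lim_seq (fun k => x k i) (l i).

Lemma is_lim_seq_sumF n (x : nat -> vec n) (l : vec n) :
  vlim x l -> is_lim_seq (fun k => sumF n (x k)) (sumF n l).
Proof.
  revert x l; induction n as [|n IH]; simpl; intros x l H.
  - apply is_lim_seq_const.
  - apply is_lim_seq_plus'; [apply H|].
    apply (IH (fun k i => x k (Fin.FS i)) (fun i => l (Fin.FS i))); intro; apply H.
Qed.

Lemma is_lim_seq_dot n (x y : nat -> vec n) (a b : vec n) :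
  vlim x a -> vlim y b -> is_lim_seq (fun k => dot (x k) (y k)) (dot a b).
Proof.
  intros Hx Hy; apply (is_lim_seq_sumF n (fun k i => x k i * y k i)); intro i.
  apply is_lim_seq_mult'; [apply Hx|apply Hy].
Qed.

Lemma is_lim_seq_norm n (x : nat -> vec n) (a : vec n) :
  vlim x a -> is_lim_seq (fun k => norm (x k)) (norm a).
Proof.
  intro H; unfold norm.
  apply (is_lim_seq_continuous sqrt); [|now apply is_lim_seq_dot].
  apply continuity_pt_sqrt, dot_self_nonneg.
Qed.

Lemma vlim_const n (a : vec n) : vlim (fun _ => a) a.
Proof. intro; apply is_lim_seq_const. Qed.

Lemma vlim_sub n (x y : nat -> vec n) a b :
  vlim x a -> vlim y b -> vlim (fun k => vsub (x k) (y k)) (vsub a b).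
Proof. intros Hx Hy i; apply is_lim_seq_minus'; auto. Qed.

Lemma is_lim_seq_squeeze0 (u v : nat -> R) :
  (forall k, Rabs (u k) <= v k) -> is_lim_seq v 0 -> is_lim_seq u 0.
Proof.
  intros H Hv.
  apply (is_lim_seq_le_le (fun k => - v k) _ v).
  - intro k; specialize (H k); apply Rabs_le_between in H; lra.
  - replace (Finite 0) with (Rbar_opp 0) by (simpl; f_equal; ring).
    now apply (is_lim_seq_opp v 0).
  - exact Hv.
Qed.

Lemma vlim_of_norm n (x : nat -> vec n) a :
  is_lim_seq (fun k => norm (vsub (x k) a)) 0 -> vlim x a.
Proof.
  intros H i.
  apply is_lim_seq_ext with (fun k => (x k i - a i) + a i); [intro; ring|].
  replace (Finite (a i)) with (Finite (0 + a i)) by (f_equal; ring).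
  apply is_lim_seq_plus'; [|apply is_lim_seq_const].
  eapply is_lim_seq_squeeze0; [|exact H].
  intro k; apply (abs_comp_le_norm n (vsub (x k) a)).
Qed.

Lemma norm_of_vlim n (x : nat -> vec n) a :
  vlim x a -> is_lim_seq (fun k => norm (vsub (x k) a)) 0.
Proof.
  intro H; rewrite <- (norm_vsub_diag n a).
  apply is_lim_seq_norm, vlim_sub; [exact H|apply vlim_const].
Qed.

Lemma vcv_vlim n (x : nat -> vec n) a : vcv x a <-> vlim x a.
Proof.
  unfold vcv; rewrite <- is_lim_seq_Reals; split; [apply vlim_of_norm|apply norm_of_vlim].
Qed.

Lemma is_lim_seq_eventually_lt (u : nat -> R) (l b : R) :
  is_lim_seq u l -> l < b -> eventually (fun k => u k < b).
Proof.
  intros H Hb; apply is_lim_seq_spec in H.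
  assert (He : 0 < b - l) by lra.
  destruct (H (mkposreal _ He)) as [N HN]; exists N; intros k Hk.
  specialize (HN k Hk); simpl in HN; apply Rabs_lt_between in HN; lra.
Qed.

Lemma is_lim_seq_eventually_gt (u : nat -> R) (l b : R) :
  is_lim_seq u l -> b < l -> eventually (fun k => b < u k).
Proof.
  intros H Hb; apply is_lim_seq_spec in H.
  assert (He : 0 < l - b) by lra.
  destruct (H (mkposreal _ He)) as [N HN]; exists N; intros k Hk.
  specialize (HN k Hk); simpl in HN; apply Rabs_lt_between in HN; lra.
Qed.

Lemma vlim_eventually_near n (x : nat -> vec n) a r :
  vlim x a -> 0 < r -> eventually (fun k => norm (vsub (x k) a) < r).
Proof. intros H Hr; eapply is_lim_seq_eventually_lt; [apply norm_of_vlim, H|exact Hr]. Qed.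

Lemma is_lim_seq_of_eps (u : nat -> R) (l : R) :
  (forall e, 0 < e -> eventually (fun k => Rabs (u k - l) < e)) -> is_lim_seq u l.
Proof. intro H; apply is_lim_seq_spec; intro e; apply H, e. Qed.

(** Extractions are not asked to be increasing: [k <= phi k] suffices for limits and is stable under
    composition and under shifts. *)
Lemma is_lim_seq_extract (phi : nat -> nat) (u : nat -> R) (l : Rbar) :
  (forall k, (k <= phi k)%nat) -> is_lim_seq u l -> is_lim_seq (fun k => u (phi k)) l.
Proof.
  intros Hphi Hu; eapply is_lim_seq_subseq; [|exact Hu].
  intros P [N HN]; exists N; intros k Hk; apply HN; specialize (Hphi k); lia.
Qed.

Lemma vlim_extract n (phi : nat -> nat) (x : nat -> vec n) a :
  (forall k, (k <= phi k)%nat) -> vlim x a -> vlim (fun k => x (phi k)) a.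
Proof. intros Hphi H i; now apply (is_lim_seq_extract phi (fun k => x k i)). Qed.

Lemma is_lim_seq_le_const (u : nat -> R) (l b : R) :
  is_lim_seq u l -> (forall k, u k <= b) -> l <= b.
Proof.
  intros H Hb.
  apply (is_lim_seq_le u (fun _ => b) (Finite l) (Finite b) Hb H (is_lim_seq_const b)).
Qed.

Lemma is_lim_seq_ge_const (u : nat -> R) (l b : R) :
  is_lim_seq u l -> (forall k, b <= u k) -> b <= l.
Proof.
  intros H Hb.
  apply (is_lim_seq_le (fun _ => b) u (Finite b) (Finite l) Hb (is_lim_seq_const b) H).
Qed.

Lemma is_lim_seq_le_real (u v : nat -> R) (a b : R) :
  (forall k, u k <= v k) -> is_lim_seq u a -> is_lim_seq v b -> a <= b.
Proof. intros H Hu Hv; exact (is_lim_seq_le u v (Finite a) (Finite b) H Hu Hv). Qed.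

Lemma is_lim_seq_inv_S : is_lim_seq (fun k => / INR (S k)) 0.
Proof.
  apply is_lim_seq_Reals; intros e He; unfold R_dist.
  destruct (archimed_cor1 e He) as [N [HN HN0]]; exists N; intros k Hk.
  rewrite Rminus_0_r, Rabs_right.
  - eapply Rle_lt_trans; [|exact HN].
    apply Rinv_le_contravar; [apply lt_0_INR; lia|apply le_INR; lia].
  - apply Rle_ge, Rlt_le, Rinv_0_lt_compat, lt_0_INR; lia.
Qed.

Lemma inv_S_pos k : 0 < / INR (S k).
Proof. apply Rinv_0_lt_compat, lt_0_INR; lia. Qed.

(** * Compactness *)

Lemma bounded_extract (u : nat -> R) (B : R) :
  (forall k, Rabs (u k) <= B) ->
  exists phi (l : R), (forall k, (k <= phi k)%nat) /\ is_lim_seq (fun k => u (phi k)) l.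
Proof.
  intro HB.
  destruct (Bolzano_Weierstrass u (fun x => - B <= x <= B)) as [l Hl].
  - apply compact_P3.
  - intro k; specialize (HB k); apply Rabs_le_between in HB; exact HB.
  - assert (H : forall k, exists p, (k <= p)%nat /\ Rabs (u p - l) < / INR (S k)).
    { intro k.
      destruct (Hl (disc l (mkposreal _ (inv_S_pos k))) k) as [p [Hp1 Hp2]].
      - exists (mkposreal _ (inv_S_pos k)); intros x Hx; exact Hx.
      - exists p; split; [exact Hp1|exact Hp2]. }
    destruct (choice _ H) as [phi Hphi].
    exists phi, l; split; [apply Hphi|].
    apply is_lim_seq_ext with (fun k => (u (phi k) - l) + l); [intro; ring|].
    replace (Finite l) with (Finite (0 + l)) by (f_equal; ring).
    apply is_lim_seq_plus'; [|apply is_lim_seq_const].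
    eapply is_lim_seq_squeeze0; [|apply is_lim_seq_inv_S].
    intro k; apply Rlt_le, Hphi.
Qed.

Lemma bounded_vextract n (x : nat -> vec n) (B : R) :
  (forall k, norm (x k) <= B) ->
  exists phi l, (forall k, (k <= phi k)%nat) /\ vlim (fun k => x (phi k)) l.
Proof.
  intro HB.
  assert (HC : forall k i, Rabs (x k i) <= B)
    by (intros k i; eapply Rle_trans; [apply abs_comp_le_norm|apply HB]).
  clear HB; revert x HC; induction n as [|n IH]; intros x HC.
  - exists (fun k => k), (x O); split; [lia|]; intro i; inversion i.
  - destruct (bounded_extract (fun k => x k Fin.F1) B (fun k => HC k _)) as [phi [a [Hphi Ha]]].
    destruct (IH (fun k i => x (phi k) (Fin.FS i)) (fun k i => HC _ _)) as [psi [l [Hpsi Hl]]].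
    exists (fun k => phi (psi k)), (fun i => Fin.caseS' i (fun _ => R) a l); split.
    + intro k; specialize (Hpsi k); specialize (Hphi (psi k)); lia.
    + intro i; pattern i; apply (Fin.caseS' i); simpl.
      * apply (is_lim_seq_extract psi (fun k => x (phi k) Fin.F1)); assumption.
      * intro j; apply (Hl j).
Qed.

Lemma near_bounded n (x : vec n) a B : norm (vsub x a) <= B -> norm x <= B + norm a.
Proof.
  intro H; replace x with (vadd (vsub x a) a)
    by (apply functional_extensionality; intro; unfold vadd, vsub; ring).
  pose proof (norm_add n (vsub x a) a); lra.
Qed.

(** * Infima and existence of minimizers *)

Lemma is_inf_exists (A : R -> Prop) :
  (exists s, A s) -> (exists b, forall s, A s -> b <= s) -> exists a, is_inf A a.
Proof.
  intros [s Hs] [b Hb].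
  destruct (completeness (fun t => A (- t))) as [l [Hl1 Hl2]].
  - exists (- b); intros t Ht; specialize (Hb _ Ht); lra.
  - exists (- s); now rewrite Ropp_involutive.
  - exists (- l); split.
    + intros t Ht; assert (- t <= l) by (apply Hl1; now rewrite Ropp_involutive); lra.
    + intros w Hw; assert (l <= - w) by (apply Hl2; intros t Ht; specialize (Hw _ Ht); lra); lra.
Qed.

Lemma is_inf_approx (A : R -> Prop) a e : is_inf A a -> 0 < e -> exists s, A s /\ s < a + e.
Proof.
  intros [_ H] He; apply NNPP; intro N.
  assert (a + e <= a); [|lra].
  apply H; intros s Hs; apply Rnot_lt_le; intro L; apply N; eauto.
Qed.

(** Weierstrass theorem with compactness of [S] and continuity of [F] merged into one hypothesis, so
    that it serves both for points of a ball and for pairs [(z, q)]. *)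
Lemma minimizer_exists {T} (S : T -> Prop) (F : T -> R) :
  (exists x, S x) ->
  (forall xk, (forall k, S (xk k)) -> exists phi x, (forall k : nat, (k <= phi k)%nat) /\ S x /\
     is_lim_seq (fun k => F (xk (phi k))) (F x)) ->
  exists x, S x /\ forall y, S y -> F x <= F y.
Proof.
  intros [x0 Hx0] HC.
  destruct (is_inf_exists (fun s => exists x, S x /\ s = F x)) as [a Ha].
  - eauto.
  - apply NNPP; intro N.
    (* If [F] were unbounded below on [S], values at most [-k] would converge along an extraction to
       a finite limit. *)
    assert (H : forall k : nat, exists x, S x /\ F x <= - INR k).
    { intro k; apply NNPP; intro M; apply N; exists (- INR k); intros s [x [Hx ->]].
      apply Rnot_lt_le; intro L; apply M; exists x; split; [exact Hx|lra]. }
    destruct (choice _ H) as [xk Hxk].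
    destruct (HC xk (fun k => proj1 (Hxk k))) as [phi [x [Hphi [_ Hlim]]]].
    destruct (is_lim_seq_eventually_gt _ _ (F x - 1) Hlim ltac:(lra)) as [N1 HN1].
    destruct (INR_archimed 1 (1 - F x) ltac:(lra)) as [N2 HN2].
    specialize (HN1 (N1 + N2)%nat ltac:(lia)); simpl in HN1.
    pose proof (proj2 (Hxk (phi (N1 + N2)%nat))).
    assert (INR N2 <= INR (phi (N1 + N2)%nat)).
    { apply le_INR; specialize (Hphi (N1 + N2)%nat); lia. }
    lra.
  - assert (H : forall k, exists x, S x /\ F x < a + / INR (Datatypes.S k)).
    { intro k; destruct (is_inf_approx _ _ _ Ha (inv_S_pos k)) as [s [[x [Hx ->]] Hs]]; eauto. }
    destruct (choice _ H) as [xk Hxk].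
    destruct (HC xk (fun k => proj1 (Hxk k))) as [phi [x [Hphi [Hx Hlim]]]].
    exists x; split; [exact Hx|]; intros y Hy.
    apply Rle_trans with a; [|apply (proj1 Ha); eauto].
    apply (is_lim_seq_le_real (fun k => F (xk (phi k))) (fun k => a + / INR (Datatypes.S (phi k)))).
    + intro k; apply Rlt_le, Hxk.
    + exact Hlim.
    + replace (Finite a) with (Finite (a + 0)) by (f_equal; ring).
      apply is_lim_seq_plus'; [apply is_lim_seq_const|].
      apply (is_lim_seq_extract phi (fun k => / INR (Datatypes.S k))); [exact Hphi|].
      apply is_lim_seq_inv_S.
Qed.

(** * Differentiability along lines and Taylor expansion *)

Lemma vsub_line n (x w : vec n) s t :
  vsub (vadd x (vscale (s + t) w)) (vadd x (vscale s w)) = vscale t w.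
Proof. apply functional_extensionality; intro; unfold vadd, vsub, vscale; ring. Qed.

(** Common core of the two derivatives along a line, with [c] standing for [|w|]. Since [c] may be
    0, the radius is divided by [c + 1]. *)
Lemma first_order_line (p : R -> R) (l c t : R) :
  0 <= c ->
  (forall e, 0 < e -> exists d, 0 < d /\ forall h, Rabs h * c < d ->
     Rabs (p (t + h) - p t - h * l) <= e * (Rabs h * c)) ->
  derivable_pt_lim p t l.
Proof.
  intros Hc H e He.
  destruct (H (e / (2 * (c + 1)))) as [d [Hd HH]].
  { apply Rdiv_lt_0_compat; lra. }
  assert (Hd' : 0 < d / (c + 1)) by (apply Rdiv_lt_0_compat; lra).
  exists (mkposreal _ Hd'); intros h Hh0 Hh; simpl in Hh.
  assert (Hp : 0 < Rabs h) by now apply Rabs_pos_lt.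
  specialize (HH h).
  assert (Hlt : Rabs h * (c + 1) < d).
  { apply Rmult_lt_compat_r with (r := c + 1) in Hh; [|lra].
    unfold Rdiv in Hh; rewrite Rmult_assoc, Rinv_l in Hh; lra. }
  specialize (HH ltac:(nra)).
  replace ((p (t + h) - p t) / h - l) with ((p (t + h) - p t - h * l) / h) by (field; exact Hh0).
  rewrite Rabs_div by exact Hh0.
  apply Rmult_lt_reg_r with (Rabs h); [exact Hp|].
  replace (Rabs (p (t + h) - p t - h * l) / Rabs h * Rabs h)
    with (Rabs (p (t + h) - p t - h * l)) by (field; lra).
  eapply Rle_lt_trans; [exact HH|].
  replace (e / (2 * (c + 1)) * (Rabs h * c)) with (e * Rabs h * (c / (c + 1)) / 2) by (field; lra).
  assert (c / (c + 1) <= 1).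
  { apply Rmult_le_reg_r with (c + 1); [lra|].
    replace (c / (c + 1) * (c + 1)) with c by (field; lra); lra. }
  assert (0 < e * Rabs h) by nra.
  assert (0 <= c / (c + 1)) by (apply Rdiv_le_0_compat; lra).
  nra.
Qed.

Lemma frechet_grad_line n (h : vec n -> R) (x w p : vec n) t :
  frechet_grad h (vadd x (vscale t w)) p ->
  derivable_pt_lim (fun s => h (vadd x (vscale s w))) t (dot p w).
Proof.
  intro H; apply (first_order_line _ _ (norm w)); [apply norm_nonneg|].
  intros e He; destruct (H e He) as [d [Hd HH]].
  exists d; split; [exact Hd|]; intros s Hs.
  specialize (HH (vadd x (vscale (t + s) w))).
  rewrite vsub_line, dot_scale_r, norm_scale in HH; auto.
Qed.

Lemma frechet_jac_line n (G : vec n -> vec n) (x w : vec n) A t :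
  frechet_jac G (vadd x (vscale t w)) A ->
  derivable_pt_lim (fun s => dot (G (vadd x (vscale s w))) w) t (quad A w).
Proof.
  intro H; apply (first_order_line _ _ (norm w)); [apply norm_nonneg|].
  intros e He.
  (* Pairing the remainder of the Jacobian with [w] costs a second factor [|w|], paid for in
     advance. *)
  assert (He' : 0 < e / (norm w + 1)).
  { pose proof (norm_nonneg n w); apply Rdiv_lt_0_compat; lra. }
  destruct (H _ He') as [d [Hd HH]].
  exists d; split; [exact Hd|]; intros s Hs.
  specialize (HH (vadd x (vscale (t + s) w))).
  rewrite vsub_line, norm_scale in HH; specialize (HH Hs).
  set (D := vsub _ _) in HH.
  replace (dot (G (vadd x (vscale (t + s) w))) w - dot (G (vadd x (vscale t w))) w - s * quad A w)
    with (dot D w).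
  - eapply Rle_trans; [apply cauchy_schwarz|].
    pose proof (norm_nonneg n w); pose proof (norm_nonneg n D).
    apply Rle_trans with (e / (norm w + 1) * (Rabs s * norm w) * norm w); [nra|].
    replace (e / (norm w + 1) * (Rabs s * norm w) * norm w)
      with (e * (Rabs s * norm w) * (norm w / (norm w + 1))) by (field; lra).
    assert (norm w / (norm w + 1) <= 1).
    { apply Rmult_le_reg_r with (norm w + 1); [lra|].
      replace (norm w / (norm w + 1) * (norm w + 1)) with (norm w) by (field; lra); lra. }
    pose proof (Rabs_pos s).
    assert (0 <= e * (Rabs s * norm w)) by (apply Rmult_le_pos; nra).
    nra.
  - unfold D; rewrite !dot_sub_l; f_equal; unfold quad.
    rewrite <- dot_scale_l; f_equal; apply functional_extensionality; intro i.
    unfold matvec; now rewrite dot_scale_r.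
Qed.

Lemma frechet_grad_lim n (h : vec n -> R) (a p : vec n) (x : nat -> vec n) :
  frechet_grad h a p -> vlim x a -> is_lim_seq (fun k => h (x k)) (h a).
Proof.
  intros H Hx; destruct (H 1 Rlt_0_1) as [d [Hd HH]].
  apply is_lim_seq_ext_loc with
    (fun k => (h (x k) - h a - dot p (vsub (x k) a)) + (h a + dot p (vsub (x k) a))).
  { exists O; intros; ring. }
  replace (Finite (h a)) with (Finite (0 + (h a + dot p vzero)))
    by (rewrite dot_zero_r; f_equal; ring).
  apply is_lim_seq_plus'.
  - apply is_lim_seq_of_eps; intros e He.
    pose proof (vlim_eventually_near n x a d Hx Hd) as E1.
    pose proof (vlim_eventually_near n x a e Hx He) as E2.
    apply (filter_imp _ _) with (2 := filter_and _ _ E1 E2).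
    intros k [A B]; rewrite Rminus_0_r; specialize (HH _ A); lra.
  - apply is_lim_seq_plus'; [apply is_lim_seq_const|].
    apply is_lim_seq_dot; [apply vlim_const|].
    rewrite <- (vsub_diag n a); apply vlim_sub; [exact Hx|apply vlim_const].
Qed.

Lemma frechet_jac_lim n (G : vec n -> vec n) (a : vec n) A (x : nat -> vec n) :
  frechet_jac G a A -> vlim x a -> vlim (fun k => G (x k)) (G a).
Proof.
  intros H Hx; destruct (H 1 Rlt_0_1) as [d [Hd HH]].
  set (D := fun k => vsub (vsub (G (x k)) (G a)) (matvec A (vsub (x k) a))).
  assert (HD : vlim D vzero).
  { apply vlim_of_norm, is_lim_seq_of_eps; intros e He.
    pose proof (vlim_eventually_near n x a d Hx Hd) as E1.
    pose proof (vlim_eventually_near n x a e Hx He) as E2.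
    apply (filter_imp _ _) with (2 := filter_and _ _ E1 E2).
    intros k [P Q]; specialize (HH _ P).
    replace (vsub (D k) vzero) with (D k)
      by (apply functional_extensionality; intro; unfold vsub, vzero; ring).
    rewrite Rminus_0_r, Rabs_right by apply Rle_ge, norm_nonneg; fold (D k) in HH; lra. }
  intro i.
  apply is_lim_seq_ext with (fun k => D k i + (dot (A i) (vsub (x k) a) + G a i)).
  { intro k; unfold D, vsub, matvec; ring. }
  replace (Finite (G a i)) with (Finite (0 + (dot (A i) vzero + G a i)))
    by (rewrite dot_zero_r; f_equal; ring).
  apply is_lim_seq_plus'; [exact (HD i)|].
  apply is_lim_seq_plus'; [|apply is_lim_seq_const].
  apply is_lim_seq_dot; [apply vlim_const|].
  rewrite <- (vsub_diag n a); apply vlim_sub; [exact Hx|apply vlim_const].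
Qed.

(** With [A = p 1 - p 0 - p' 0], the function [p t - p' 0 t - A t^2] agrees at 0 and 1, so
    [p' c - p' 0 = 2 A c] for some [c] in [(0, 1)]; the mean value theorem for [p'] on [[0, c]] then
    gives [2 A]. *)
Lemma taylor2_1d (p p' p'' : R -> R) :
  (forall t, 0 <= t <= 1 -> derivable_pt_lim p t (p' t)) ->
  (forall t, 0 <= t <= 1 -> derivable_pt_lim p' t (p'' t)) ->
  exists c, 0 <= c <= 1 /\ p 1 - p 0 - p' 0 = p'' c / 2.
Proof.
  intros H1 H2; set (A := p 1 - p 0 - p' 0).
  destruct (MVT_cor2 (fun t => p t - (p' 0 * t + A * (t * t)))
              (fun t => p' t - (p' 0 * 1 + A * (1 * t + t * 1))) 0 1 ltac:(lra)) as [c [Hc Hc1]].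
  { intros c Hc; apply derivable_pt_lim_minus; [now apply H1|].
    apply (derivable_pt_lim_plus (fun t => p' 0 * t) (fun t => A * (t * t))).
    - apply (derivable_pt_lim_scal (fun t => t)), derivable_pt_lim_id.
    - apply (derivable_pt_lim_scal (fun t => t * t)).
      apply (derivable_pt_lim_mult (fun t => t) (fun t => t)); apply derivable_pt_lim_id. }
  destruct (MVT_cor2 p' p'' 0 c ltac:(lra)) as [b [Hb Hb1]].
  { intros t Ht; apply H2; lra. }
  exists b; split; [lra|].
  unfold A in *; clear A; nra.
Qed.

Lemma quad_scale n (A : mat n) a u : quad A (vscale a u) = a * a * quad A u.
Proof.
  unfold quad; rewrite dot_scale_r.
  replace (matvec A (vscale a u)) with (vscale a (matvec A u)).
  - rewrite dot_scale_l; ring.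
  - apply functional_extensionality; intro i; unfold matvec; now rewrite dot_scale_r.
Qed.

Lemma is_lim_seq_quad n (A : nat -> mat n) (B : mat n) (u : nat -> vec n) v :
  (forall i j, is_lim_seq (fun k => A k i j) (B i j)) -> vlim u v ->
  is_lim_seq (fun k => quad (A k) (u k)) (quad B v).
Proof.
  intros HA Hu; apply is_lim_seq_dot; [|exact Hu].
  intro i; apply is_lim_seq_dot; [|exact Hu]; intro j; apply HA.
Qed.

Lemma segment_near n (x y a : vec n) c r : 0 <= c <= 1 ->
  norm (vsub x a) < r -> norm (vsub y a) < r ->
  norm (vsub (vadd x (vscale c (vsub y x))) a) < r.
Proof.
  intros Hc Hx Hy.
  replace (vsub (vadd x (vscale c (vsub y x))) a)
    with (vadd (vscale (1 - c) (vsub x a)) (vscale c (vsub y a)))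
    by (apply functional_extensionality; intro; unfold vadd, vsub, vscale; ring).
  eapply Rle_lt_trans; [apply norm_add|].
  rewrite !norm_scale, !Rabs_right by lra.
  destruct (Req_dec c 0); [subst; lra|nra].
Qed.

Lemma taylor2 n (h : vec n -> R) dh d2h a r x y :
  (forall z, norm (vsub z a) < r -> frechet_grad h z (dh z) /\ frechet_jac dh z (d2h z)) ->
  norm (vsub x a) < r -> norm (vsub y a) < r ->
  exists c, 0 <= c <= 1 /\
    h y - h x - dot (dh x) (vsub y x) = quad (d2h (vadd x (vscale c (vsub y x)))) (vsub y x) / 2.
Proof.
  intros H Hx Hy; set (w := vsub y x).
  destruct (taylor2_1d (fun t => h (vadd x (vscale t w))) (fun t => dot (dh (vadd x (vscale t w))) w)
     (fun t => quad (d2h (vadd x (vscale t w))) w)) as [c [Hc E]].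
  - intros t Ht; apply frechet_grad_line, H, segment_near; assumption.
  - intros t Ht; apply frechet_jac_line, H, segment_near; assumption.
  - exists c; split; [exact Hc|]; rewrite <- E.
    replace (vadd x (vscale 1 w)) with y
      by (apply functional_extensionality; intro; unfold w, vadd, vsub, vscale; ring).
    replace (vadd x (vscale 0 w)) with x
      by (apply functional_extensionality; intro; unfold w, vadd, vsub, vscale; ring).
    reflexivity.
Qed.

(** Both endpoints move. The mean-value point lies on the segment between them, hence also tends to
    [a], and continuity of the Hessian at [a] gives the limit. *)
Lemma taylor2_lim n (h : vec n -> R) dh d2h a (x y : nat -> vec n) (t : nat -> R) u :
  C2_near h dh d2h a -> vlim x a -> vlim y a -> (forall k, 0 < t k) ->
  vlim (fun k => vscale (/ t k) (vsub (y k) (x k))) u ->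
  is_lim_seq (fun k => (h (y k) - h (x k) - dot (dh (x k)) (vsub (y k) (x k))) / (t k * t k))
    (quad (d2h a) u / 2).
Proof.
  intros [r [Hr H]] Hx Hy Ht Hu.
  assert (HC : forall k, exists c, 0 <= c <= 1 /\
    (norm (vsub (x k) a) < r -> norm (vsub (y k) a) < r ->
     h (y k) - h (x k) - dot (dh (x k)) (vsub (y k) (x k)) =
     quad (d2h (vadd (x k) (vscale c (vsub (y k) (x k))))) (vsub (y k) (x k)) / 2)).
  { intro k.
    destruct (Rlt_dec (norm (vsub (x k) a)) r) as [A|A]; [|exists 0; split; [lra|intro; lra]].
    destruct (Rlt_dec (norm (vsub (y k) a)) r) as [B|B]; [|exists 0; split; [lra|intros; lra]].
    destruct (taylor2 n h dh d2h a r (x k) (y k)) as [c [Hc E]]; auto.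
    - intros z Hz; destruct (H z Hz) as [? [? ?]]; auto.
    - exists c; auto. }
  destruct (choice _ HC) as [c Hc]; clear HC.
  set (xi := fun k => vadd (x k) (vscale (c k) (vsub (y k) (x k)))).
  assert (Hxi : vlim xi a).
  { apply vlim_of_norm.
    apply (is_lim_seq_squeeze0 _ (fun k => norm (vsub (x k) a) + norm (vsub (y k) a))).
    - intro k; rewrite Rabs_right by apply Rle_ge, norm_nonneg.
      destruct (Hc k) as [Hck _].
      replace (vsub (xi k) a)
        with (vadd (vscale (1 - c k) (vsub (x k) a)) (vscale (c k) (vsub (y k) a)))
        by (apply functional_extensionality; intro; unfold xi, vadd, vsub, vscale; ring).
      eapply Rle_trans; [apply norm_add|].
      rewrite !norm_scale, !Rabs_right by lra.
      pose proof (norm_nonneg n (vsub (x k) a)); pose proof (norm_nonneg n (vsub (y k) a)); nra.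
    - replace (Finite 0) with (Finite (0 + 0)) by (f_equal; ring).
      apply is_lim_seq_plus'; now apply norm_of_vlim. }
  apply is_lim_seq_ext_loc with
    (fun k => quad (d2h (xi k)) (vscale (/ t k) (vsub (y k) (x k))) * / 2).
  - apply (filter_imp _ _) with
      (2 := filter_and _ _ (vlim_eventually_near n x a r Hx Hr) (vlim_eventually_near n y a r Hy Hr)).
    intros k [A B]; destruct (Hc k) as [_ E]; rewrite (E A B); fold (xi k).
    rewrite quad_scale; specialize (Ht k); field; lra.
  - apply is_lim_seq_mult'; [|apply is_lim_seq_const].
    apply is_lim_seq_quad; [|exact Hu].
    intros i j; apply is_lim_seq_of_eps; intros e He.
    destruct (H a) as [_ [_ Hcont]]; [rewrite norm_vsub_diag; exact Hr|].
    destruct (Hcont i j e He) as [d [Hd HH]].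
    apply (filter_imp _ _) with (2 := vlim_eventually_near n xi a d Hxi Hd).
    intros k Hk; apply HH, Hk.
Qed.

Lemma C2_near_grad_lim n (h : vec n -> R) dh d2h a (x : nat -> vec n) :
  C2_near h dh d2h a -> vlim x a -> vlim (fun k => dh (x k)) (dh a).
Proof.
  intros [r [Hr H]] Hx; destruct (H a) as [_ [HJ _]]; [rewrite norm_vsub_diag; exact Hr|].
  now apply (frechet_jac_lim n dh a (d2h a)).
Qed.

Lemma C2_near_lim n (h : vec n -> R) dh d2h a (x : nat -> vec n) :
  C2_near h dh d2h a -> vlim x a -> is_lim_seq (fun k => h (x k)) (h a).
Proof.
  intros [r [Hr H]] Hx; destruct (H a) as [HG _]; [rewrite norm_vsub_diag; exact Hr|].
  now apply (frechet_grad_lim n h a (dh a)).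
Qed.

(** Read off from [taylor2_lim]: the first-order remainder is [t k] times a convergent quotient. *)
Lemma taylor1_lim n (h : vec n -> R) dh d2h a (x y : nat -> vec n) (t : nat -> R) u :
  C2_near h dh d2h a -> vlim x a -> vlim y a -> (forall k, 0 < t k) -> is_lim_seq t 0 ->
  vlim (fun k => vscale (/ t k) (vsub (y k) (x k))) u ->
  is_lim_seq (fun k => (h (y k) - h (x k)) / t k) (dot (dh a) u).
Proof.
  intros H Hx Hy Ht Ht0 Hu.
  apply is_lim_seq_ext with
    (fun k => dot (dh (x k)) (vscale (/ t k) (vsub (y k) (x k))) +
       t k * ((h (y k) - h (x k) - dot (dh (x k)) (vsub (y k) (x k))) / (t k * t k))).
  { intro k; rewrite dot_scale_r; specialize (Ht k); field; lra. }
  replace (Finite (dot (dh a) u)) with (Finite (dot (dh a) u + 0 * (quad (d2h a) u / 2)))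
    by (f_equal; ring).
  apply is_lim_seq_plus'.
  - apply is_lim_seq_dot; [|exact Hu]; eapply C2_near_grad_lim; eauto.
  - apply is_lim_seq_mult'; [exact Ht0|]; now apply taylor2_lim.
Qed.

Lemma C2_near_shrink n (h : vec n -> R) dh d2h a :
  C2_near h dh d2h a -> exists r, 0 < r /\ forall x, norm (vsub x a) < r -> C2_near h dh d2h x.
Proof.
  intros [r [Hr H]]; exists (r / 2); split; [lra|]; intros x Hx.
  exists (r / 2); split; [lra|]; intros y Hy; apply H.
  pose proof (norm_vsub_triangle n y x a); lra.
Qed.

Lemma C2_near_here n (h : vec n -> R) dh d2h a :
  C2_near h dh d2h a -> frechet_grad h a (dh a).
Proof.
  intros [r [Hr H]]; apply H; rewrite norm_vsub_diag; exact Hr.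
Qed.

Lemma common_radius N (P : Fin.t N -> R -> Prop) :
  (forall i r s, P i r -> 0 < s <= r -> P i s) ->
  (forall i, exists r, 0 < r /\ P i r) -> exists r, 0 < r /\ forall i, P i r.
Proof.
  induction N as [|N IH]; intros Hmono H.
  - exists 1; split; [lra|]; intro i; inversion i.
  - destruct (IH (fun i => P (Fin.FS i)) (fun i => Hmono _) (fun i => H _)) as [r [Hr HP]].
    destruct (H Fin.F1) as [s [Hs Hs1]].
    pose proof (Rmin_l r s); pose proof (Rmin_r r s); pose proof (Rmin_glb_lt r s 0 Hr Hs).
    exists (Rmin r s); split; [assumption|].
    intro i; pattern i; apply (Fin.caseS' i).
    + apply Hmono with s; auto.
    + intro j; apply Hmono with r; auto.
Qed.

(** * Multipliers under metric subregularity *)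

Definition adj {n N} (J : Fin.t N -> vec n) (l : vec N) : vec n :=
  fun j => sumF N (fun i => l i * J i j).

Lemma dot_adj n N (J : Fin.t N -> vec n) l w :
  dot (adj J l) w = sumF N (fun i => l i * dot (J i) w).
Proof.
  unfold dot, adj.
  transitivity (sumF n (fun j => sumF N (fun i => l i * J i j * w j))).
  - apply sumF_ext; intro j; rewrite Rmult_comm, <- sumF_scal; apply sumF_ext; intro; ring.
  - rewrite sumF_exchange; apply sumF_ext; intro i; rewrite <- sumF_scal; apply sumF_ext.
    intro; ring.
Qed.

Lemma vlim_adj n N (J : nat -> Fin.t N -> vec n) J0 (l : nat -> vec N) l0 :
  (forall i, vlim (fun k => J k i) (J0 i)) -> vlim l l0 -> vlim (fun k => adj (J k) (l k)) (adj J0 l0).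
Proof.
  intros HJ Hl j; apply (is_lim_seq_sumF N (fun k i => l k i * J k i j)); intro i.
  apply is_lim_seq_mult'; [apply Hl|apply (HJ i j)].
Qed.

Lemma derivable_pt_lim_sumF N (p : Fin.t N -> R -> R) (l : vec N) t :
  (forall i, derivable_pt_lim (p i) t (l i)) ->
  derivable_pt_lim (fun s => sumF N (fun i => p i s)) t (sumF N l).
Proof.
  revert p l; induction N as [|N IH]; simpl; intros p l H.
  - apply derivable_pt_lim_const.
  - apply (derivable_pt_lim_plus (p Fin.F1)); [apply H|].
    apply (IH (fun i => p (Fin.FS i)) (fun i => l (Fin.FS i))); intro; apply H.
Qed.

Lemma right_derivative_bound (p : R -> R) l c d :
  derivable_pt_lim p 0 l -> 0 < d -> (forall t, 0 <= t < d -> p 0 - c * t <= p t) -> - c <= l.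
Proof.
  intros H Hd Hp; apply Rnot_lt_le; intro L.
  destruct (H (- c - l) ltac:(lra)) as [e He].
  pose proof (cond_pos e) as Hepos; pose proof (Rmin_glb_lt d e 0 Hd Hepos) as Hm.
  pose proof (Rmin_l d e); pose proof (Rmin_r d e).
  set (t := Rmin d e / 2); assert (Ht : 0 < t < d) by (unfold t; lra).
  specialize (He t ltac:(lra) ltac:(rewrite Rabs_right; unfold t in *; lra)).
  specialize (Hp t ltac:(lra)); rewrite Rplus_0_l in He.
  apply Rabs_lt_between in He; destruct He as [_ He].
  assert (p t - p 0 < - c * t); [|lra].
  apply Rmult_lt_reg_r with (/ t); [apply Rinv_0_lt_compat; lra|].
  replace (- c * t * / t) with (- c) by (field; lra).
  fold ((p t - p 0) / t); lra.
Qed.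

Lemma norm_le_of_dot n (p : vec n) e : 0 <= e -> (forall w, - (e * norm w) <= dot p w) -> norm p <= e.
Proof.
  intros He H; specialize (H (vopp p)); rewrite norm_opp, dot_comm, dot_opp_l, <- norm_sq in H.
  pose proof (norm_nonneg n p); destruct (Req_dec (norm p) 0); nra.
Qed.

Definition convex_set {N} (C : vec N -> Prop) : Prop :=
  forall a b t, C a -> C b -> 0 <= t <= 1 -> C (vadd a (vscale t (vsub b a))).

Definition seq_closed {N} (C : vec N -> Prop) : Prop :=
  forall x a, (forall k : nat, C (x k)) -> vlim x a -> C a.

Lemma quadratic_first_order a b : (forall t, 0 < t <= 1 -> 0 <= t * t * b - 2 * t * a) -> a <= 0.
Proof.
  intro H; apply Rnot_lt_le; intro L.
  destruct (Rle_dec b 0) as [B|B]; [specialize (H 1 ltac:(lra)); nra|].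
  (* This value of [t] lies in [(0, 1)] and satisfies [t b < a], so the quadratic is negative
     there. *)
  assert (Hq : 0 < a / (a + b)) by (apply Rdiv_lt_0_compat; lra).
  assert (E : a / (a + b) * (a + b) = a) by (field; lra).
  set (t := a / (a + b)) in *.
  specialize (H t ltac:(split; nra)).
  assert (t * b < a) by nra. nra.
Qed.

(** * The multiplier rule for a closed convex set [C], by quadratic penalization *)

Section Multiplier.
Variables (n N : nat) (C : vec N -> Prop).
Hypothesis Cconv : convex_set C.
Hypothesis Cclosed : seq_closed C.
Variables (G : vec n -> vec N) (DG : Fin.t N -> vec n -> vec n) (D2G : Fin.t N -> vec n -> mat n).
Variables (x xs : vec n) (r sigma : R).
Hypothesis r_pos : 0 < r.
Hypothesis sigma_pos : 0 < sigma.
Hypothesis G_C2 : forall z i, norm (vsub z x) < r -> C2_near (fun y => G y i) (DG i) (D2G i) z.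
(** Subregularity without distance functions: an arbitrary [q] in [C] replaces the distance to [C],
    and the slack [e] replaces the projection on the feasible set. *)
Hypothesis subreg : forall z q e, norm (vsub z x) < r -> C q -> 0 < e ->
  exists y, C (G y) /\ norm (vsub z y) <= sigma * norm (vsub (G z) q) + e.
Hypothesis xs_normal : frechet_normal (fun y => C (G y)) x xs.

(** The term [e |z - x|] of the penalty is left out, being nonsmooth at [x];
    [approximate_multiplier] accounts for it as an admissible slope [-e |w|]. *)
Lemma penalty_derivative z q K w : norm (vsub z x) < r ->
  derivable_pt_lim
    (fun t => - dot xs (vsub (vadd z (vscale t w)) x)
       + K / 2 * dot (vsub (G (vadd z (vscale t w))) q) (vsub (G (vadd z (vscale t w))) q)) 0
    (dot (vsub (adj (fun i => DG i z) (vscale K (vsub (G z) q))) xs) w).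
Proof.
  intro Hz.
  assert (E0 : vadd z (vscale 0 w) = z)
    by (apply functional_extensionality; intro; unfold vadd, vscale; ring).
  rewrite dot_sub_l, dot_adj.
  replace (sumF N (fun i => vscale K (vsub (G z) q) i * dot (DG i z) w) - dot xs w)
    with (- dot xs w + K / 2 * sumF N (fun i => dot (DG i z) w * (G z i - q i)
                                       + (G z i - q i) * dot (DG i z) w)).
  2:{ rewrite <- sumF_scal.
      replace (sumF N (fun i => K / 2 * (dot (DG i z) w * (G z i - q i) + (G z i - q i) * dot (DG i z) w)))
        with (sumF N (fun i => vscale K (vsub (G z) q) i * dot (DG i z) w))
        by (apply sumF_ext; intro; unfold vscale, vsub; field).
      ring. }
  apply (derivable_pt_lim_plus (fun t => - dot xs (vsub (vadd z (vscale t w)) x))).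
  - apply (derivable_pt_lim_opp (fun t => dot xs (vsub (vadd z (vscale t w)) x))).
    apply (frechet_grad_line n (fun y => dot xs (vsub y x))); rewrite E0; intros e He; exists 1; split; [lra|]; intros y _.
    rewrite <- !dot_sub_r.
    replace (vsub (vsub (vsub y x) (vsub z x)) (vsub y z)) with (@vzero n)
      by (apply functional_extensionality; intro; unfold vsub, vzero; ring).
    rewrite dot_zero_r, Rabs_R0; pose proof (norm_nonneg n (vsub y z)); nra.
  - apply (derivable_pt_lim_scal (fun t => dot (vsub (G (vadd z (vscale t w))) q) (vsub (G (vadd z (vscale t w))) q))).
    apply (derivable_pt_lim_sumF N
      (fun i t => vsub (G (vadd z (vscale t w))) q i * vsub (G (vadd z (vscale t w))) q i)).
    intro i; unfold vsub.
    assert (D : derivable_pt_lim (fun t => G (vadd z (vscale t w)) i - q i) 0 (dot (DG i z) w)).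
    { replace (dot (DG i z) w) with (dot (DG i z) w - 0) by ring.
      apply (derivable_pt_lim_minus (fun t => G (vadd z (vscale t w)) i) (fun _ => q i));
        [|apply derivable_pt_lim_const].
      apply (frechet_grad_line n (fun y => G y i)); rewrite E0.
      apply (C2_near_here n _ _ (D2G i)), G_C2, Hz. }
    pose proof (derivable_pt_lim_mult _ _ _ _ _ D D) as P; simpl in P.
    rewrite E0 in P; exact P.
Qed.

(* Minimising [-<xs,z-x> + e |z-x| + (K/2) |G z - q|^2] jointly in [z] and [q \in C] yields
   [l = K (G z - q)]; since [q] is optimal for the fixed [z], no differentiability of the
   distance to [C] is needed, and subregularity bounds [K |G z - q|] independently of [K]. *)
Lemma approximate_multiplier e : 0 < e ->
  exists z l q, norm (vsub z x) <= e /\ norm (vsub (G z) q) <= e /\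
    (forall p, C p -> norm (vsub p (G x)) <= 1 -> dot l (vsub p q) <= 0) /\
    norm (vsub (adj (fun i => DG i z) l) xs) <= e /\
    norm l <= 2 * sigma * (norm xs + e).
Proof.
  intro He; destruct xs_normal as [HCx Hnorm].
  destruct (Hnorm (e / 2) ltac:(lra)) as [d [Hd HN]].
  pose proof (norm_nonneg n xs) as Hxs.
  set (rho := Rmin (Rmin r d) e / 4).
  assert (Hrho : 0 < rho /\ rho < r /\ 3 * rho < d /\ rho < e).
  { pose proof (Rmin_l (Rmin r d) e); pose proof (Rmin_r (Rmin r d) e).
    pose proof (Rmin_l r d); pose proof (Rmin_r r d).
    pose proof (Rmin_glb_lt _ _ _ (Rmin_glb_lt r d 0 r_pos Hd) He); unfold rho; lra. }
  (* Lipschitz cost, in terms of the residual [D], of moving from [z] to a nearby feasible point. *)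
  set (A := (e / 2 + norm xs) * sigma).
  assert (HA : 0 < A) by (unfold A; nra).
  (* The three summands have separate tasks: [HK1] gives [sigma D <= rho / 2], so that feasible
     points near [z] stay where the normal inequality is valid; [HK2] puts [z] in the interior of
     the ball; [HK3] gives [D <= e]. *)
  set (K := 1 + 8 * norm xs * sigma * sigma / rho + 8 * A * A / (e * rho) + 2 * A / e).
  assert (Hk1 : 0 <= 8 * norm xs * sigma * sigma / rho).
  { apply Rdiv_le_0_compat; [|lra]; repeat apply Rmult_le_pos; lra. }
  assert (Hk2 : 0 < 8 * A * A / (e * rho)) by (apply Rdiv_lt_0_compat; nra).
  assert (Hk3 : 0 < 2 * A / e) by (apply Rdiv_lt_0_compat; nra).
  assert (HK : 1 < K) by (unfold K; lra).
  assert (HK1 : 8 * norm xs * sigma * sigma <= K * rho).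
  { replace (8 * norm xs * sigma * sigma) with (8 * norm xs * sigma * sigma / rho * rho) by (field; lra).
    apply Rmult_le_compat_r; unfold K; lra. }
  assert (HK2 : 8 * A * A <= K * (e * rho)).
  { replace (8 * A * A) with (8 * A * A / (e * rho) * (e * rho)) by (field; lra).
    apply Rmult_le_compat_r; [nra|unfold K; lra]. }
  assert (HK3 : 2 * A <= K * e).
  { replace (2 * A) with (2 * A / e * e) by (field; lra).
    apply Rmult_le_compat_r; unfold K; lra. }
  clearbody K.
  set (F := fun zq : vec n * vec N => - dot xs (vsub (fst zq) x) + e * norm (vsub (fst zq) x)
              + K / 2 * dot (vsub (G (fst zq)) (snd zq)) (vsub (G (fst zq)) (snd zq))).
  (* The bound on [q] provides compactness. Its price is that the variational inequality is only
     obtained for [p] within distance 1 of [G x]; [normal_multiplier] removes this restriction. *)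
  set (S := fun zq : vec n * vec N => norm (vsub (fst zq) x) <= rho /\ C (snd zq) /\
              norm (vsub (snd zq) (G x)) <= 1).
  destruct (minimizer_exists S F) as [[z q] [[Hz [Hq Hq1]] Hmin]].
  { exists (x, G x); unfold S; simpl; rewrite !norm_vsub_diag; repeat split; [lra|exact HCx|lra]. }
  { intros zq HS.
    destruct (bounded_vextract n (fun k => fst (zq k)) (rho + norm x)) as [phi [z [Hphi Hz]]].
    { intro k; apply near_bounded, HS. }
    destruct (bounded_vextract N (fun k => snd (zq (phi k))) (1 + norm (G x))) as [psi [q [Hpsi Hq]]].
    { intro k; apply near_bounded, HS. }
    apply (vlim_extract n psi) in Hz; [|exact Hpsi].
    assert (Hzr : norm (vsub z x) <= rho).
    { apply (is_lim_seq_le_const (fun k => norm (vsub (fst (zq (phi (psi k)))) x))).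
      - apply is_lim_seq_norm, vlim_sub; [exact Hz|apply vlim_const].
      - intro k; apply HS. }
    exists (fun k => phi (psi k)), (z, q); split; [|split; [split; [|split]|]]; simpl.
    - intro k; specialize (Hpsi k); specialize (Hphi (psi k)); lia.
    - exact Hzr.
    - apply (Cclosed (fun k => snd (zq (phi (psi k))))); [intro; apply HS|exact Hq].
    - apply (is_lim_seq_le_const (fun k => norm (vsub (snd (zq (phi (psi k)))) (G x)))).
      + apply is_lim_seq_norm, vlim_sub; [exact Hq|apply vlim_const].
      + intro k; apply HS.
    - assert (HG : vlim (fun k => G (fst (zq (phi (psi k))))) (G z)).
      { intro i; apply (C2_near_lim n (fun y => G y i) (DG i) (D2G i) z); [apply G_C2; lra|exact Hz]. }
      unfold F; simpl; apply is_lim_seq_plus'; [apply is_lim_seq_plus'|].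
      + apply (is_lim_seq_opp _ (Finite (dot xs (vsub z x)))).
        apply is_lim_seq_dot; [apply vlim_const|]; apply vlim_sub; [exact Hz|apply vlim_const].
      + apply is_lim_seq_mult'; [apply is_lim_seq_const|].
        apply is_lim_seq_norm, vlim_sub; [exact Hz|apply vlim_const].
      + apply is_lim_seq_mult'; [apply is_lim_seq_const|].
        apply is_lim_seq_dot; apply vlim_sub; assumption. }
  simpl in Hz, Hq, Hq1.
  assert (H0 : F (z, q) <= 0).
  { replace 0 with (F (x, G x)).
    - apply Hmin; unfold S; simpl; rewrite !norm_vsub_diag; repeat split; [lra|exact HCx|lra].
    - unfold F; simpl; rewrite !vsub_diag, dot_zero_r, norm_zero, dot_zero_r; ring. }
  unfold F in H0; simpl in H0.
  rewrite <- norm_sq in H0.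
  set (D := norm (vsub (G z) q)) in *; set (T := norm (vsub z x)) in *.
  assert (HD0 : 0 <= D) by apply norm_nonneg.
  assert (HT0 : 0 <= T) by apply norm_nonneg.
  assert (HsD : sigma * D <= rho / 2).
  { pose proof (dot_le_norm n xs (vsub z x)) as P; fold T in P.
    assert (Hxr : norm xs * T <= norm xs * rho) by (apply Rmult_le_compat_l; assumption).
    assert (He0 : 0 <= e * T) by nra.
    assert (P1 : K / 2 * (D * D) <= norm xs * rho) by lra.
    assert (P2 : K * (D * D) * (4 * sigma * sigma) <= (2 * norm xs * rho) * (4 * sigma * sigma)).
    { apply Rmult_le_compat_r; nra. }
    assert (P3 : (8 * norm xs * sigma * sigma) * rho <= K * rho * rho).
    { apply Rmult_le_compat_r; lra. }
    assert (P4 : K * ((2 * sigma * D) * (2 * sigma * D)) <= K * (rho * rho)) by nra.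
    apply Rmult_le_reg_l in P4; [|lra].
    assert (0 <= 2 * sigma * D) by nra.
    nra. }
  (* Comparison with [(x, G x)] bounds [e T + K/2 D^2] by [<xs, z - x>]. Splitting at a feasible [y]
     near [z], the part [<xs, y - x>] costs only [e/2 |y - x|] by normality, and [|z - y|] is at
     most [sigma D] up to [eta']. *)
  assert (Hkey : e / 2 * T + K / 2 * (D * D) <= A * D).
  { apply le_epsilon; intros eta Heta.
    set (eta' := Rmin (rho / 2) (eta / (e / 2 + norm xs))).
    assert (Hpos : 0 < eta / (e / 2 + norm xs)) by (apply Rdiv_lt_0_compat; lra).
    assert (Heta' : 0 < eta') by (apply Rmin_glb_lt; lra).
    destruct (subreg z q eta' ltac:(unfold T in Hz; lra) Hq Heta') as [y [HCy Hy]].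
    pose proof (Rmin_l (rho / 2) (eta / (e / 2 + norm xs))) as M1.
    pose proof (Rmin_r (rho / 2) (eta / (e / 2 + norm xs))) as M2.
    fold eta' in M1, M2; fold D in Hy.
    pose proof (norm_vsub_triangle n y z x) as Tr; rewrite (norm_vsub_sym n y z) in Tr; fold T in Tr.
    specialize (HN y HCy ltac:(lra)).
    pose proof (dot_le_norm n xs (vsub z y)) as CS.
    replace (vsub z x) with (vadd (vsub y x) (vsub z y)) in H0
      by (apply functional_extensionality; intro; unfold vadd, vsub; ring).
    rewrite dot_add_r in H0.
    assert (M3 : eta' * (e / 2 + norm xs) <= eta).
    { apply Rle_trans with (eta / (e / 2 + norm xs) * (e / 2 + norm xs)); [|right; field; lra].
      apply Rmult_le_compat_r; lra. }
    assert (M4 : (e / 2 + norm xs) * norm (vsub z y) <= (e / 2 + norm xs) * (sigma * D + eta'))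
      by (apply Rmult_le_compat_l; lra).
    assert (M5 : e / 2 * norm (vsub y x) <= e / 2 * (norm (vsub z y) + T))
      by (apply Rmult_le_compat_l; lra).
    unfold A; nra. }
  assert (HKD : K * D <= 2 * A).
  { destruct HD0 as [HD0|HD0]; [|rewrite <- HD0; lra].
    apply Rmult_le_reg_r with D; [exact HD0|]; nra. }
  assert (HTlt : T < rho).
  { assert (e * T <= 2 * A * D) by nra.
    assert (K * (e * T) <= 4 * (A * A)) by nra.
    assert (H4 : K * (e * T) <= K * (e * (rho / 2))) by lra.
    apply Rmult_le_reg_l in H4; [|lra]; apply Rmult_le_reg_l in H4; lra. }
  set (l := vscale K (vsub (G z) q)).
  assert (Hl : norm l = K * D).
  { unfold l; rewrite norm_scale, Rabs_right; [reflexivity|lra]. }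
  exists z, l, q; repeat split.
  - fold T; lra.
  - fold D; apply Rmult_le_reg_l with K; lra.
  (* Minimality in [q] alone, along the segment from [q] to [p]. *)
  - intros p Hp Hp1; unfold l; rewrite dot_scale_l.
    assert (Hle : dot (vsub (G z) q) (vsub p q) <= 0); [|nra].
    apply (quadratic_first_order _ (dot (vsub p q) (vsub p q))); intros t Ht.
    set (q' := vadd q (vscale t (vsub p q))).
    assert (HS' : S (z, q')).
    { unfold S; simpl; split; [exact Hz|split].
      - apply Cconv; [exact Hq|exact Hp|lra].
      - replace (vsub q' (G x)) with (vadd (vscale (1 - t) (vsub q (G x))) (vscale t (vsub p (G x))))
          by (apply functional_extensionality; intro; unfold q', vadd, vsub, vscale; ring).
        eapply Rle_trans; [apply norm_add|]; rewrite !norm_scale, !Rabs_right by lra; nra. }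
    specialize (Hmin _ HS'); unfold F in Hmin; simpl in Hmin.
    replace (vsub (G z) q') with (vsub (vsub (G z) q) (vscale t (vsub p q))) in Hmin
      by (apply functional_extensionality; intro; unfold q', vadd, vsub, vscale; ring).
    rewrite (dot_sub_l N (vsub (G z) q) (vscale t (vsub p q))) in Hmin.
    rewrite !(dot_sub_r N (vsub (G z) q) (vscale t (vsub p q))) in Hmin.
    rewrite (dot_comm N (vscale t (vsub p q)) (vsub (G z) q)) in Hmin.
    rewrite dot_scale_l, !dot_scale_r in Hmin.
    set (a := dot (vsub (G z) q) (vsub p q)) in *; set (b := dot (vsub p q) (vsub p q)) in *.
    set (g := dot (vsub (G z) q) (vsub (G z) q)) in *.
    assert (0 <= K / 2 * (t * t * b - 2 * t * a)) by lra.
    apply Rmult_le_reg_l with (K / 2); lra.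
  (* Minimality in [z] alone; since [T < rho], a short move in any direction [w] stays in the
     ball. *)
  - apply norm_le_of_dot; [lra|]; intro w.
    assert (Hd' : 0 < (rho - T) / (norm w + 1)).
    { pose proof (norm_nonneg n w); apply Rdiv_lt_0_compat; lra. }
    eapply right_derivative_bound with (d := (rho - T) / (norm w + 1));
      [apply (penalty_derivative z q K w); fold T; lra|exact Hd'|].
    intros t Ht.
    assert (E0 : vadd z (vscale 0 w) = z)
      by (apply functional_extensionality; intro; unfold vadd, vscale; ring).
    cbv beta; rewrite E0; set (z' := vadd z (vscale t w)).
    assert (Hzz : norm (vsub z' z) = t * norm w).
    { unfold z'; rewrite vsub_vadd, norm_scale, Rabs_right; lra. }
    pose proof (norm_vsub_triangle n z' z x) as Tr; fold T in Tr.
    assert (Hw : t * norm w <= rho - T).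
    { pose proof (norm_nonneg n w).
      apply Rle_trans with ((rho - T) / (norm w + 1) * (norm w + 1)); [nra|].
      right; field; lra. }
    assert (HS' : S (z', q)).
    { unfold S; simpl; split; [lra|split; assumption]. }
    specialize (Hmin _ HS'); unfold F in Hmin; simpl in Hmin; fold T in Hmin.
    assert (e * norm (vsub z' x) <= e * (t * norm w + T)) by (apply Rmult_le_compat_l; lra).
    lra.
  - rewrite Hl; unfold A in HKD; nra.
Qed.

(** The bound on approximate multipliers does not involve the penalty parameter, so they accumulate
    as the tolerance [1/(k+1)] tends to 0, while [z] and [q] tend to [x] and [G x]. *)
Lemma normal_multiplier :
  exists l, (forall p, C p -> dot l (vsub p (G x)) <= 0) /\
    adj (fun i => DG i x) l = xs /\ norm l <= 2 * sigma * norm xs.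
Proof.
  destruct (choice _ (fun k => approximate_multiplier _ (inv_S_pos k))) as [z Hz].
  destruct (choice _ Hz) as [l0 Hl0]; clear Hz.
  destruct (choice _ Hl0) as [q0 H]; clear Hl0.
  pose proof (norm_nonneg n xs) as Hxs.
  destruct (bounded_vextract N l0 (2 * sigma * (norm xs + 1))) as [phi [l [Hphi Hl]]].
  { intro k; destruct (H k) as (_ & _ & _ & _ & B); eapply Rle_trans; [exact B|].
    assert (/ INR (S k) <= 1).
    { rewrite <- Rinv_1; apply Rinv_le_contravar; [lra|]; rewrite S_INR.
      pose proof (pos_INR k); lra. }
    nra. }
  pose proof (is_lim_seq_extract phi _ _ Hphi is_lim_seq_inv_S) as Hs.
  assert (Hz : vlim (fun k => z (phi k)) x).
  { apply vlim_of_norm; eapply is_lim_seq_squeeze0; [|exact Hs].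
    intro k; rewrite Rabs_right by apply Rle_ge, norm_nonneg; apply H. }
  assert (HG : vlim (fun k => G (z (phi k))) (G x)).
  { intro i; apply (C2_near_lim n (fun y => G y i) (DG i) (D2G i) x); [|exact Hz].
    apply G_C2; rewrite norm_vsub_diag; exact r_pos. }
  assert (Hq : vlim (fun k => q0 (phi k)) (G x)).
  { intro i.
    apply is_lim_seq_ext with (fun k => G (z (phi k)) i - (vsub (G (z (phi k))) (q0 (phi k)) i)).
    { intro; unfold vsub; ring. }
    replace (Finite (G x i)) with (Finite (G x i - 0)) by (f_equal; ring).
    apply is_lim_seq_minus'; [apply HG|].
    eapply is_lim_seq_squeeze0; [|exact Hs]; intro k.
    eapply Rle_trans; [apply abs_comp_le_norm|apply H]. }
  assert (VI : forall p, C p -> norm (vsub p (G x)) <= 1 -> dot l (vsub p (G x)) <= 0).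
  { intros p Hp Hp1.
    apply (is_lim_seq_le_const (fun k => dot (l0 (phi k)) (vsub p (q0 (phi k))))).
    - apply is_lim_seq_dot; [exact Hl|]; apply vlim_sub; [apply vlim_const|exact Hq].
    - intro k; destruct (H (phi k)) as (_ & _ & V & _); now apply V. }
  exists l; split; [|split].
  - intros p Hp; destruct xs_normal as [HCx _].
    pose proof (norm_nonneg N (vsub p (G x))) as Hn.
    (* Pulls [p] towards [G x] to within distance 1; by convexity the new point is in [C], and the
       pairing is just multiplied by [t]. *)
    set (t := / (1 + norm (vsub p (G x)))).
    assert (Ht : 0 < t) by (apply Rinv_0_lt_compat; lra).
    assert (Ht1 : t * (1 + norm (vsub p (G x))) = 1) by (apply Rinv_l; lra).
    specialize (VI (vadd (G x) (vscale t (vsub p (G x))))).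
    rewrite vsub_vadd, dot_scale_r, norm_scale, Rabs_right in VI by lra.
    assert (t * dot l (vsub p (G x)) <= 0).
    { apply VI; [apply Cconv; [exact HCx|exact Hp|split; nra]|nra]. }
    nra.
  - apply norm_vsub_eq0, Rle_antisym; [|apply norm_nonneg].
    apply (is_lim_seq_le_real
      (fun k => norm (vsub (adj (fun i => DG i (z (phi k))) (l0 (phi k))) xs))
      (fun k => / INR (S (phi k)))); [intro k; apply H| |exact Hs].
    apply is_lim_seq_norm, vlim_sub; [|apply vlim_const].
    apply vlim_adj; [|exact Hl]; intro i.
    apply (C2_near_grad_lim n (fun y => G y i) (DG i) (D2G i)); [|exact Hz].
    apply G_C2; rewrite norm_vsub_diag; exact r_pos.
  - apply (is_lim_seq_le_real (fun k => norm (l0 (phi k)))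
      (fun k => 2 * sigma * (norm xs + / INR (S (phi k))))); [intro k; apply H| |].
    + now apply is_lim_seq_norm.
    + replace (2 * sigma * norm xs) with (2 * sigma * (norm xs + 0)) by ring.
      apply is_lim_seq_mult'; [apply is_lim_seq_const|].
      apply is_lim_seq_plus'; [apply is_lim_seq_const|exact Hs].
Qed.
End Multiplier.

(** * The second-order cone *)

(* Pairs [(q_0, q_r) : R * vec m] are encoded as vectors of dimension [S m], so that
   [dot], [norm] and [vlim] apply to them. *)
Definition vcons {m} (a : R) (v : vec m) : vec (S m) := fun i => Fin.caseS' i (fun _ => R) a v.
Definition tl {m} (q : vec (S m)) : vec m := fun i => q (Fin.FS i).
Definition soc {m} (q : vec (S m)) : Prop := norm (tl q) <= q Fin.F1.
Definition soc_polar {m} (l : vec (S m)) : Prop := norm (tl l) <= - l Fin.F1.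

Lemma dot_S m (a b : vec (S m)) : dot a b = a Fin.F1 * b Fin.F1 + dot (tl a) (tl b).
Proof. reflexivity. Qed.

Lemma vec_S_ext m (a b : vec (S m)) : a Fin.F1 = b Fin.F1 -> tl a = tl b -> a = b.
Proof.
  intros H0 H; apply functional_extensionality; intro i; pattern i; apply (Fin.caseS' i).
  - exact H0.
  - intro j; exact (f_equal (fun v => v j) H).
Qed.

(** Cauchy-Schwarz together with [|l_r| <= -l_0]. Besides the sign of [<l, q>] it controls how far
    [q] is from the boundary of the cone, which [soc_lorentz_gap] needs. *)
Lemma soc_polar_dot m (l q : vec (S m)) :
  soc q -> soc_polar l -> - l Fin.F1 * (q Fin.F1 - norm (tl q)) <= - dot l q.
Proof.
  unfold soc, soc_polar; intros Hq Hl; rewrite dot_S.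
  pose proof (dot_le_norm m (tl l) (tl q)); pose proof (norm_nonneg m (tl q)).
  pose proof (norm_nonneg m (tl l)); nra.
Qed.

Lemma soc_polar_dot_le m (l q : vec (S m)) : soc q -> soc_polar l -> dot l q <= 0.
Proof.
  intros Hq Hl; pose proof (soc_polar_dot m l q Hq Hl); unfold soc, soc_polar in *.
  pose proof (norm_nonneg m (tl l)); nra.
Qed.

Lemma soc_convex m : convex_set (@soc m).
Proof.
  unfold convex_set, soc; intros a b t Ha Hb Ht.
  replace (tl (vadd a (vscale t (vsub b a)))) with (vadd (vscale (1 - t) (tl a)) (vscale t (tl b)))
    by (apply functional_extensionality; intro; unfold tl, vadd, vsub, vscale; ring).
  eapply Rle_trans; [apply norm_add|]; rewrite !norm_scale, !Rabs_right by lra.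
  unfold vadd, vscale, vsub; nra.
Qed.

Lemma soc_closed m : seq_closed (@soc m).
Proof.
  intros x a Hx Hlim; apply (is_lim_seq_le_real (fun k => norm (tl (x k))) (fun k => x k Fin.F1)).
  - exact Hx.
  - apply is_lim_seq_norm; intro i; apply Hlim.
  - apply Hlim.
Qed.

Lemma soc_polar_closed m : seq_closed (@soc_polar m).
Proof.
  intros x a Hx Hlim; apply (is_lim_seq_le_real (fun k => norm (tl (x k))) (fun k => - x k Fin.F1)).
  - exact Hx.
  - apply is_lim_seq_norm; intro i; apply Hlim.
  - apply (is_lim_seq_opp _ (Finite (a Fin.F1))), Hlim.
Qed.

Lemma soc_scale m a (q : vec (S m)) : 0 <= a -> soc q -> soc (vscale a q).
Proof.
  unfold soc; intros Ha Hq; change (tl (vscale a q)) with (vscale a (tl q)).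
  rewrite norm_scale, Rabs_right by lra; unfold vscale; nra.
Qed.

Lemma soc_zero m : soc (@vzero (S m)).
Proof. unfold soc; change (tl (@vzero (S m))) with (@vzero m); rewrite norm_zero; apply Rle_refl. Qed.

(** Testing with [0] and [2 q] gives [<l, q> = 0], hence [<l, p> <= 0] on the whole cone. *)
Lemma soc_normal m (l q : vec (S m)) :
  soc q -> (forall p, soc p -> dot l (vsub p q) <= 0) -> soc_polar l /\ dot l q = 0.
Proof.
  intros Hq H.
  assert (H0 : dot l q = 0).
  { pose proof (H _ (soc_zero m)) as A; pose proof (H _ (soc_scale m 2 q ltac:(lra) Hq)) as B.
    rewrite dot_sub_r, dot_zero_r in A; rewrite dot_sub_r, dot_scale_r in B; lra. }
  split; [|exact H0]; unfold soc_polar.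
  assert (H1 : forall p, soc p -> dot l p <= 0)
    by (intros p Hp; specialize (H p Hp); rewrite dot_sub_r in H; lra).
  set (p := vcons (norm (tl l)) (tl l)).
  assert (Hp : soc p) by (unfold soc; apply Rle_refl).
  specialize (H1 p Hp) as P; rewrite dot_S in P; change (tl p) with (tl l) in P.
  rewrite <- norm_sq in P; change (p Fin.F1) with (norm (tl l)) in P.
  (* The test point [(|l_r|, l_r)] gives [|l_r| (l_0 + |l_r|) <= 0]; it is inconclusive when
     [l_r = 0], where the axis point [(1, 0)] is used. *)
  destruct (norm_nonneg m (tl l)) as [L|L]; [nra|rewrite <- L].
  set (e := vcons 1 (@vzero m)).
  assert (He : soc e).
  { unfold soc; change (tl e) with (@vzero m); rewrite norm_zero; unfold e; simpl; lra. }
  specialize (H1 e He) as P'; rewrite dot_S in P'; change (tl e) with (@vzero m) in P'.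
  rewrite dot_zero_r in P'; unfold e in P'; simpl in P'; lra.
Qed.

(** Says that [q_0 l = -l_0 (-q_0, q_r)]. With [<l_r, q_r> = -l_0 q_0], the square of
    [q_0 l_r + l_0 q_r] is [q_0^2 |l_r|^2 + l_0^2 |q_r|^2 - 2 l_0^2 q_0^2 <= 0]. *)
Lemma soc_complementary m (l q : vec (S m)) :
  soc q -> soc_polar l -> dot l q = 0 ->
  forall i, q Fin.F1 * tl l i = - l Fin.F1 * tl q i.
Proof.
  unfold soc, soc_polar; intros Hq Hl H.
  assert (E : vadd (vscale (q Fin.F1) (tl l)) (vscale (l Fin.F1) (tl q)) = vzero).
  { apply dot_self_eq0, Rle_antisym; [|apply dot_self_nonneg].
    rewrite dot_add_l, !dot_add_r, !dot_scale_l, !dot_scale_r, (dot_comm m (tl q) (tl l)).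
    rewrite dot_S in H; rewrite <- !norm_sq.
    pose proof (norm_nonneg m (tl q)); pose proof (norm_nonneg m (tl l)).
    assert (A : norm (tl q) * norm (tl q) <= q Fin.F1 * q Fin.F1) by nra.
    assert (B : norm (tl l) * norm (tl l) <= l Fin.F1 * l Fin.F1) by nra.
    assert (q Fin.F1 * q Fin.F1 * (norm (tl l) * norm (tl l)) <= q Fin.F1 * q Fin.F1 * (l Fin.F1 * l Fin.F1))
      by (apply Rmult_le_compat_l; nra).
    assert (l Fin.F1 * l Fin.F1 * (norm (tl q) * norm (tl q)) <= l Fin.F1 * l Fin.F1 * (q Fin.F1 * q Fin.F1))
      by (apply Rmult_le_compat_l; nra).
    replace (dot (tl l) (tl q)) with (- (l Fin.F1 * q Fin.F1)) by lra.
    nra. }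
  intro i; apply (f_equal (fun v => v i)) in E; unfold vadd, vscale, vzero in E; lra.
Qed.

(** By [soc_complementary] both [l] and [mu] are multiples of [(-w_0, w_r)], and [w_0 > 0]. *)
Lemma soc_polar_parallel m (l mu w : vec (S m)) :
  soc w -> w <> vzero -> soc_polar l -> soc_polar mu -> dot l w = 0 -> dot mu w = 0 ->
  vscale (l Fin.F1) mu = vscale (mu Fin.F1) l.
Proof.
  intros Hw Hw0 Hl Hmu El Emu.
  pose proof (soc_complementary m l w Hw Hl El) as A.
  pose proof (soc_complementary m mu w Hw Hmu Emu) as B.
  assert (P : 0 < w Fin.F1).
  { unfold soc in Hw; pose proof (norm_nonneg m (tl w)) as Hn.
    destruct (Rle_lt_or_eq_dec 0 (w Fin.F1) ltac:(lra)) as [L|L]; [exact L|exfalso; apply Hw0].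
    apply vec_S_ext; [symmetry; exact L|]; apply norm_eq0; lra. }
  apply vec_S_ext; [unfold vscale; ring|].
  apply functional_extensionality; intro i; specialize (A i); specialize (B i).
  change (l Fin.F1 * tl mu i = mu Fin.F1 * tl l i).
  apply Rmult_eq_reg_l with (w Fin.F1); [|lra].
  replace (w Fin.F1 * (l Fin.F1 * tl mu i)) with (l Fin.F1 * (w Fin.F1 * tl mu i)) by ring.
  replace (w Fin.F1 * (mu Fin.F1 * tl l i)) with (mu Fin.F1 * (w Fin.F1 * tl l i)) by ring.
  rewrite A, B; ring.
Qed.

Lemma soc_polar_head0 m (l : vec (S m)) : soc_polar l -> l Fin.F1 = 0 -> l = vzero.
Proof.
  unfold soc_polar; intros H E; apply vec_S_ext; [exact E|].
  apply norm_eq0; pose proof (norm_nonneg m (tl l)); lra.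
Qed.

(** Signed as in the side condition on [u], hence nonpositive on the cone. *)
Definition lorentz {m} (q : vec (S m)) : R := dot (tl q) (tl q) - q Fin.F1 * q Fin.F1.

Lemma soc_lorentz_le m (q : vec (S m)) :
  soc q -> 0 <= - lorentz q <= 2 * q Fin.F1 * (q Fin.F1 - norm (tl q)).
Proof.
  unfold soc, lorentz; intro H; rewrite <- norm_sq; pose proof (norm_nonneg m (tl q)); split; nra.
Qed.

(** Expand the form at [p - q]. Complementarity kills [l_0 lorentz q] and turns the mixed term into
    [2 q_0 <l, p>], while [l_0 lorentz p] lies between 0 and [-2 p_0 <l, p>]. For [p = G y] and
    [q = G x] near the vertex, the factor [p_0 + q_0] is what makes the bound vanish in the
    limit. *)
Lemma soc_lorentz_gap m (l p q : vec (S m)) :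
  soc p -> soc q -> soc_polar l -> dot l q = 0 ->
  Rabs (l Fin.F1 * lorentz (vsub p q)) <= 2 * (p Fin.F1 + q Fin.F1) * - dot l p.
Proof.
  intros Hp Hq Hl E.
  pose proof (soc_complementary m l q Hq Hl E) as A.
  assert (A' : forall y, q Fin.F1 * dot (tl l) y = - l Fin.F1 * dot (tl q) y).
  { intro y; rewrite <- !dot_scale_l; f_equal; apply functional_extensionality; exact A. }
  assert (Gp : q Fin.F1 * - dot l p = l Fin.F1 * (dot (tl q) (tl p) - q Fin.F1 * p Fin.F1)).
  { rewrite dot_S; specialize (A' (tl p)); lra. }
  assert (Gq : l Fin.F1 * lorentz q = 0).
  { specialize (A' (tl q)); rewrite dot_S in E; unfold lorentz; nra. }
  assert (Ex : l Fin.F1 * lorentz (vsub p q) = l Fin.F1 * lorentz p - 2 * (q Fin.F1 * - dot l p)).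
  { rewrite Gp.
    replace (lorentz (vsub p q))
      with (lorentz p + lorentz q - 2 * (dot (tl q) (tl p) - q Fin.F1 * p Fin.F1)).
    - rewrite Rmult_minus_distr_l, Rmult_plus_distr_l, Gq; ring.
    - unfold lorentz; change (tl (vsub p q)) with (vsub (tl p) (tl q)).
      rewrite dot_sub_l, !dot_sub_r, (dot_comm m (tl q) (tl p)); unfold vsub; ring. }
  rewrite Ex.
  pose proof (soc_lorentz_le m p Hp) as [L1 L2].
  pose proof (soc_polar_dot m l p Hp Hl) as D.
  pose proof (soc_polar_dot_le m l p Hp Hl).
  assert (Hl0 : 0 <= - l Fin.F1) by (unfold soc_polar in Hl; pose proof (norm_nonneg m (tl l)); lra).
  assert (Hp0 : 0 <= p Fin.F1) by (unfold soc in Hp; pose proof (norm_nonneg m (tl p)); lra).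
  assert (Hq0 : 0 <= q Fin.F1) by (unfold soc in Hq; pose proof (norm_nonneg m (tl q)); lra).
  assert (0 <= - l Fin.F1 * - lorentz p) by nra.
  assert (- l Fin.F1 * - lorentz p <= - l Fin.F1 * (2 * p Fin.F1 * (p Fin.F1 - norm (tl p))))
    by (apply Rmult_le_compat_l; assumption).
  assert (2 * p Fin.F1 * (- l Fin.F1 * (p Fin.F1 - norm (tl p))) <= 2 * p Fin.F1 * - dot l p)
    by (apply Rmult_le_compat_l; lra).
  assert (0 <= q Fin.F1 * - dot l p) by nra.
  apply Rabs_le; split; lra.
Qed.

(** * Limits of multipliers *)

Lemma is_lim_seq_eq (u : nat -> R) (a b : R) : is_lim_seq u a -> is_lim_seq u b -> a = b.
Proof.
  intros Ha Hb; apply is_lim_seq_unique in Ha; apply is_lim_seq_unique in Hb.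
  rewrite Ha in Hb; now injection Hb.
Qed.

Section Limits.
Variables (n m : nat) (f : vec n -> R) (df : vec n -> vec n) (d2f : vec n -> mat n).
Variables (G : vec n -> vec (S m)) (DG : Fin.t (S m) -> vec n -> vec n)
  (D2G : Fin.t (S m) -> vec n -> mat n) (xbar : vec n).
Hypothesis f_C2 : C2_near f df d2f xbar.
Hypothesis G_C2 : forall i, C2_near (fun z => G z i) (DG i) (D2G i) xbar.
Hypothesis G_xbar : G xbar = vzero.

Let jac (x : vec n) : Fin.t (S m) -> vec n := fun i => DG i x.
Let hess (l : vec (S m)) (u : vec n) : R := sumF (S m) (fun i => l i * quad (D2G i xbar) u).

Lemma G_lim (x : nat -> vec n) : vlim x xbar -> vlim (fun k => G (x k)) vzero.
Proof.
  intros Hx i; rewrite <- G_xbar.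
  exact (C2_near_lim n (fun z => G z i) (DG i) (D2G i) xbar x (G_C2 i) Hx).
Qed.

Lemma adj_lim (x : nat -> vec n) l lb :
  vlim x xbar -> vlim l lb -> vlim (fun k => adj (jac (x k)) (l k)) (adj (jac xbar) lb).
Proof.
  intros Hx Hl; apply vlim_adj; [|exact Hl]; intro i.
  exact (C2_near_grad_lim n (fun z => G z i) (DG i) (D2G i) xbar x (G_C2 i) Hx).
Qed.

Section Pairing.
Variables (x y : nat -> vec n) (t : nat -> R) (u : vec n) (l : nat -> vec (S m)) (lb : vec (S m)).
Hypothesis x_lim : vlim x xbar.
Hypothesis y_lim : vlim y xbar.
Hypothesis t_pos : forall k, 0 < t k.
Hypothesis u_lim : vlim (fun k => vscale (/ t k) (vsub (y k) (x k))) u.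
Hypothesis l_lim : vlim l lb.

(** The weights [l k] vary with [k], so the expansion is done for each component of [G] and weighted
    afterwards. *)
Lemma pairing_taylor2_lim :
  is_lim_seq (fun k => (dot (l k) (G (y k)) - dot (l k) (G (x k))
      - dot (adj (jac (x k)) (l k)) (vsub (y k) (x k))) / (t k * t k))
    (hess lb u / 2).
Proof.
  apply is_lim_seq_ext with (fun k => sumF (S m) (fun i => l k i *
    ((G (y k) i - G (x k) i - dot (DG i (x k)) (vsub (y k) (x k))) / (t k * t k)))).
  { intro k; rewrite dot_adj, <- dot_sub_r; unfold dot at 2; unfold Rdiv.
    rewrite (Rmult_comm _ (/ _)).
    replace (sumF (S m) (fun i => l k i * vsub (G (y k)) (G (x k)) i)
       - sumF (S m) (fun i => l k i * dot (jac (x k) i) (vsub (y k) (x k))))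
      with (sumF (S m) (fun i => l k i * vsub (G (y k)) (G (x k)) i
         + (-1) * (l k i * dot (jac (x k) i) (vsub (y k) (x k)))))
      by (rewrite sumF_plus, sumF_scal; ring).
    rewrite <- sumF_scal; apply sumF_ext; intro i; unfold jac, vsub at 2; ring. }
  unfold hess; replace (sumF (S m) (fun i => lb i * quad (D2G i xbar) u) / 2)
    with (sumF (S m) (fun i => lb i * (quad (D2G i xbar) u / 2))).
  2:{ unfold Rdiv at 2; rewrite Rmult_comm, <- sumF_scal; apply sumF_ext; intro; field. }
  apply (is_lim_seq_sumF (S m) (fun k i => l k i *
    ((G (y k) i - G (x k) i - dot (DG i (x k)) (vsub (y k) (x k))) / (t k * t k)))).
  intro i; apply is_lim_seq_mult'; [apply l_lim|].
  exact (taylor2_lim n (fun z => G z i) (DG i) (D2G i) xbar x y t u (G_C2 i) x_lim y_lim t_pos u_lim).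
Qed.

Hypothesis t_lim : is_lim_seq t 0.

Lemma G_taylor1_lim :
  vlim (fun k => vscale (/ t k) (vsub (G (y k)) (G (x k)))) (fun i => dot (DG i xbar) u).
Proof.
  intro i; apply is_lim_seq_ext with (fun k => (G (y k) i - G (x k) i) / t k).
  { intro k; unfold vscale, vsub, Rdiv; ring. }
  exact (taylor1_lim n (fun z => G z i) (DG i) (D2G i) xbar x y t u
    (G_C2 i) x_lim y_lim t_pos t_lim u_lim).
Qed.

Lemma pairing_taylor1_lim :
  is_lim_seq (fun k => (dot (l k) (G (y k)) - dot (l k) (G (x k))) / t k) (dot (adj (jac xbar) lb) u).
Proof.
  rewrite dot_adj.
  apply is_lim_seq_ext with (fun k => dot (l k) (vscale (/ t k) (vsub (G (y k)) (G (x k))))).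
  { intro k; rewrite dot_scale_r, dot_sub_r; unfold Rdiv; ring. }
  exact (is_lim_seq_dot (S m) _ _ _ _ l_lim G_taylor1_lim).
Qed.
End Pairing.

Lemma norm_vsub_lim0 (x y : nat -> vec n) :
  vlim x xbar -> vlim y xbar -> is_lim_seq (fun k => norm (vsub (y k) (x k))) 0.
Proof.
  intros Hx Hy; rewrite <- (norm_vsub_diag n xbar).
  now apply is_lim_seq_norm, vlim_sub.
Qed.

(** The relative bound with constant [c] is there for [xs = 0]: the multipliers of 0 form a cone,
    and without the bound [lb] could be a nonzero, non-maximal element of it. *)
Lemma directional_multiplier_lim (x : nat -> vec n) (l : nat -> vec (S m)) xs v lb c :
  (forall k, soc (G (x k))) -> (forall k, x k <> xbar) -> vlim x xbar ->
  vlim (fun k => vscale (/ norm (vsub (x k) xbar)) (vsub (x k) xbar)) v ->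
  (forall k, soc_polar (l k)) -> (forall k, dot (l k) (G (x k)) = 0) -> vlim l lb ->
  vlim (fun k => adj (jac (x k)) (l k)) xs ->
  (forall k, norm (l k) <= c * norm (adj (jac (x k)) (l k))) ->
  critical (fun y => soc (G y)) xbar xs v /\ norm v = 1 /\
  soc_polar lb /\ adj (jac xbar) lb = xs /\
  forall mu, soc_polar mu -> adj (jac xbar) mu = xs -> hess mu v <= hess lb v.
Proof.
  intros HF Hne Hx Hv Hpol Hcompl Hl Hadj Hbnd.
  set (s := fun k => norm (vsub (x k) xbar)) in *.
  assert (Hs : forall k, 0 < s k) by (intro; apply norm_vsub_pos, Hne).
  pose proof (norm_vsub_lim0 (fun _ => xbar) x (vlim_const n xbar) Hx) as Hs0.
  change (is_lim_seq s 0) in Hs0.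
  assert (Hlb : soc_polar lb) by (apply (soc_polar_closed m l); assumption).
  assert (Eadj : adj (jac xbar) lb = xs).
  { apply functional_extensionality; intro i.
    exact (is_lim_seq_eq _ _ _ (adj_lim x l lb Hx Hl i) (Hadj i)). }
  split; [split|split; [|split; [exact Hlb|split; [exact Eadj|]]]].
  - exists s, (fun k => vscale (/ s k) (vsub (x k) xbar)); split; [exact Hs|].
    split; [now apply is_lim_seq_Reals|]; split; [now apply vcv_vlim|]; intro k.
    replace (vadd xbar (vscale (s k) (vscale (/ s k) (vsub (x k) xbar)))) with (x k); [apply HF|].
    apply functional_extensionality; intro; unfold vadd, vscale, vsub.
    specialize (Hs k); field; lra.
  (* The first-order quotients of the pairing vanish identically, by complementarity at [x k] and
     [G xbar = 0]. *)
  - rewrite <- Eadj.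
    refine (is_lim_seq_eq _ _ _
      (pairing_taylor1_lim (fun _ => xbar) x s v l lb (vlim_const n xbar) Hx Hs Hv Hl Hs0) _).
    apply is_lim_seq_ext with (fun _ => 0); [|apply is_lim_seq_const].
    intro k; rewrite Hcompl, G_xbar, dot_zero_r; unfold Rdiv; ring.
  - apply (is_lim_seq_eq (fun k => norm (vscale (/ s k) (vsub (x k) xbar)))).
    + now apply is_lim_seq_norm.
    + apply is_lim_seq_ext with (fun _ => 1); [|apply is_lim_seq_const].
      intro k; symmetry; apply norm_normalized, Hs.
  - intros mu Hmu Emu; apply Rnot_lt_le; intro L.
    (* If [mu] were better, then [h s^2 <= -<lb, q_k> <= |l_k - lb| |q_k|], hence [s^2 = o(|q_k|)];
       a limit [w] of [q_k/|q_k|] is then orthogonal to both [lb] and [mu], which makes them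
       parallel, so that [xs = 0] and therefore [lb = 0]. *)
    set (tau := vsub mu lb); set (q := fun k => G (x k)).
    (* The two multipliers have the same adjoint image, so the first-order term of [tau] drops
       out. *)
    assert (HT : is_lim_seq (fun k => dot tau (q k) / (s k * s k)) (hess tau v / 2)).
    { eapply is_lim_seq_ext;
        [|exact (pairing_taylor2_lim (fun _ => xbar) x s v (fun _ => tau) tau
            (vlim_const n xbar) Hx Hs Hv (vlim_const _ tau))].
      intro k; cbv beta; rewrite G_xbar, dot_zero_r.
      replace (dot (adj (jac xbar) tau) (vsub (x k) xbar)) with 0; [f_equal; unfold q; ring|].
      assert (E : adj (jac xbar) tau = vsub (adj (jac xbar) mu) (adj (jac xbar) lb)).
      { apply functional_extensionality; intro j; unfold vsub at 1, adj.
        replace (sumF (S m) (fun i => mu i * jac xbar i j) - sumF (S m) (fun i => lb i * jac xbar i j))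
          with (sumF (S m) (fun i => mu i * jac xbar i j + (-1) * (lb i * jac xbar i j)))
          by (rewrite sumF_plus, sumF_scal; ring).
        apply sumF_ext; intro; unfold tau, vsub; ring. }
      rewrite E, Emu, Eadj, vsub_diag, dot_zero_l; reflexivity. }
    assert (Hpos : 0 < hess tau v / 2).
    { replace (hess tau v) with (hess mu v - hess lb v); [lra|].
      unfold hess.
      replace (sumF (S m) (fun i => mu i * quad (D2G i xbar) v) - sumF (S m) (fun i => lb i * quad (D2G i xbar) v))
        with (sumF (S m) (fun i => mu i * quad (D2G i xbar) v + (-1) * (lb i * quad (D2G i xbar) v)))
        by (rewrite sumF_plus, sumF_scal; ring).
      apply sumF_ext; intro; unfold tau, vsub; ring. }
    (* Half of the positive limit in [HT], hence a strict lower bound from some [K0] on. *)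
    set (h := hess tau v / 4).
    assert (Hh : 0 < h) by (unfold h; lra).
    destruct (is_lim_seq_eventually_gt _ _ h HT ltac:(unfold h; lra)) as [K0 HK0].
    assert (Hgap : forall k, (K0 <= k)%nat ->
      h * (s k * s k) < - dot lb (q k) /\ - dot lb (q k) <= norm (vsub (l k) lb) * norm (q k)).
    { intros k Hk; specialize (HK0 k Hk); specialize (Hs k).
      assert (P : h * (s k * s k) < dot tau (q k)).
      { apply Rmult_lt_reg_r with (/ (s k * s k)); [apply Rinv_0_lt_compat; nra|].
        replace (h * (s k * s k) * / (s k * s k)) with h by (field; lra); exact HK0. }
      unfold tau in P; rewrite dot_sub_l in P.
      pose proof (soc_polar_dot_le m mu (q k) (HF k) Hmu); split; [lra|].
      pose proof (dot_le_norm (S m) (vsub (l k) lb) (q k)) as CS.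
      rewrite dot_sub_l in CS; unfold q in *; rewrite Hcompl in CS; lra. }
    assert (Hlb0 : lb <> vzero).
    { intro E; destruct (Hgap K0 (le_n _)) as [P _]; rewrite E, dot_zero_l in P.
      specialize (Hs K0); nra. }
    assert (Hqpos : forall k, (K0 <= k)%nat -> 0 < norm (q k)).
    { intros k Hk; destruct (Hgap k Hk) as [P Q]; specialize (Hs k).
      pose proof (norm_nonneg (S m) (q k)) as [A|A]; [exact A|].
      rewrite <- A, Rmult_0_r in Q; nra. }
    (* The shift by [K0] is needed for the normalization: [q k] is known to be nonzero only from
       there on. *)
    set (w0 := fun k => vscale (/ norm (q (K0 + k)%nat)) (q (K0 + k)%nat)).
    destruct (bounded_vextract (S m) w0 1) as [phi [w [Hphi Hw]]].
    { intro k; right; apply norm_normalized, Hqpos; lia. }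
    set (psi := fun k => (K0 + phi k)%nat).
    assert (Hpsi : forall k, (k <= psi k)%nat) by (intro k; specialize (Hphi k); unfold psi; lia).
    assert (Hpsi0 : forall k, (K0 <= psi k)%nat) by (intro; unfold psi; lia).
    change (vlim (fun k => vscale (/ norm (q (psi k))) (q (psi k))) w) in Hw.
    assert (Hw1 : norm w = 1).
    { eapply is_lim_seq_eq; [apply (is_lim_seq_norm _ _ _ Hw)|].
      apply is_lim_seq_ext with (fun _ => 1); [|apply is_lim_seq_const].
      intro k; symmetry; apply norm_normalized, Hqpos, Hpsi0. }
    assert (Hwsoc : soc w).
    { refine (soc_closed m _ _ _ Hw); intro k; apply soc_scale; [|apply HF].
      apply Rlt_le, Rinv_0_lt_compat, Hqpos, Hpsi0. }
    assert (Elb : dot lb w = 0).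
    { eapply is_lim_seq_eq;
        [apply is_lim_seq_dot; [apply (vlim_extract _ psi l lb Hpsi Hl)|exact Hw]|].
      apply is_lim_seq_ext with (fun _ => 0); [|apply is_lim_seq_const].
      intro k; rewrite dot_scale_r; unfold q; rewrite Hcompl; ring. }
    assert (Etau : dot tau w = 0).
    { eapply is_lim_seq_eq; [apply is_lim_seq_dot; [apply (vlim_const _ tau)|exact Hw]|].
      set (R1 := fun k => s (psi k) * s (psi k) / norm (q (psi k))).
      assert (HR1 : is_lim_seq R1 0).
      { apply (is_lim_seq_squeeze0 _ (fun k => / h * norm (vsub (l (psi k)) lb))).
        - intro k; destruct (Hgap _ (Hpsi0 k)) as [P Q].
          specialize (Hqpos _ (Hpsi0 k)); specialize (Hs (psi k)).
          unfold R1; rewrite Rabs_right.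
          + apply Rmult_le_reg_r with (h * norm (q (psi k))); [nra|].
            replace (s (psi k) * s (psi k) / norm (q (psi k)) * (h * norm (q (psi k))))
              with (h * (s (psi k) * s (psi k))) by (field; lra).
            replace (/ h * norm (vsub (l (psi k)) lb) * (h * norm (q (psi k))))
              with (norm (vsub (l (psi k)) lb) * norm (q (psi k))) by (field; lra).
            lra.
          + apply Rle_ge, Rdiv_le_0_compat; nra.
        - replace (Finite 0) with (Finite (/ h * 0)) by (f_equal; ring).
          apply is_lim_seq_mult'; [apply is_lim_seq_const|].
          apply norm_of_vlim, vlim_extract; assumption. }
      apply is_lim_seq_ext with
        (fun k => dot tau (q (psi k)) / (s (psi k) * s (psi k)) * R1 k).
      { intro k; rewrite dot_scale_r; unfold R1.
        specialize (Hqpos _ (Hpsi0 k)); specialize (Hs (psi k)); field; lra. }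
      replace (Finite 0) with (Finite (hess tau v / 2 * 0)) by (f_equal; ring).
      apply is_lim_seq_mult'; [|exact HR1].
      exact (is_lim_seq_extract psi _ _ Hpsi HT). }
    assert (Emu0 : dot mu w = 0) by (unfold tau in Etau; rewrite dot_sub_l in Etau; lra).
    assert (Hw0 : w <> vzero) by (intro E; rewrite E, norm_zero in Hw1; lra).
    pose proof (soc_polar_parallel m lb mu w Hwsoc Hw0 Hlb Hmu Elb Emu0) as Par.
    (* Since [lb] and [mu] both have image [xs], either their heads agree, which makes them equal
       and contradicts [L], or [xs = 0]. *)
    assert (Hpar : vscale (lb Fin.F1) xs = vscale (mu Fin.F1) xs).
    { assert (Hsc : forall a z, adj (jac xbar) (vscale a z) = vscale a (adj (jac xbar) z)).
      { intros a z; apply functional_extensionality; intro j; unfold vscale at 2, adj.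
        rewrite <- sumF_scal; apply sumF_ext; intro; unfold vscale; ring. }
      rewrite <- Emu at 1; rewrite <- Eadj; rewrite <- !Hsc, Par; reflexivity. }
    destruct (Req_dec (lb Fin.F1) (mu Fin.F1)) as [E|E].
    + assert (Hl1 : lb Fin.F1 <> 0) by (intro Z; apply Hlb0, soc_polar_head0; assumption).
      assert (Z : mu = lb).
      { apply functional_extensionality; intro i; apply (f_equal (fun z => z i)) in Par.
        unfold vscale in Par; rewrite <- E in Par; apply Rmult_eq_reg_l in Par; assumption. }
      rewrite Z in L; lra.
    + apply Hlb0, norm_eq0.
      assert (Z : xs = vzero).
      { apply functional_extensionality; intro i; apply (f_equal (fun z => z i)) in Hpar.
        unfold vscale in Hpar; unfold vzero.
        assert ((lb Fin.F1 - mu Fin.F1) * xs i = 0) by lra.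
        destruct (Rmult_integral _ _ H) as [A|A]; [lra|exact A]. }
      apply Rle_antisym; [|apply norm_nonneg].
      apply (is_lim_seq_le_real (fun k => norm (l k)) (fun k => c * norm (adj (jac (x k)) (l k)))).
      * exact Hbnd.
      * now apply is_lim_seq_norm.
      * replace 0 with (c * norm xs) by (rewrite Z, norm_zero; ring).
        apply is_lim_seq_mult'; [apply is_lim_seq_const|now apply is_lim_seq_norm].
Qed.

(** All three conclusions follow from [0 <= e k / t^2 <= b k] with [b] convergent, where
    [e k = -<l k, G (y k)>]. The points [x k] may equal [xbar], and [strict_local_minimizer] takes
    them constant. *)
Lemma growth_violation_lim (kappa : R) (x y v : nat -> vec n) (l : nat -> vec (S m)) u lb :
  0 < kappa ->
  (forall k, soc (G (x k))) -> (forall k, soc (G (y k))) -> vlim x xbar -> vlim y xbar ->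
  (forall k, y k <> x k) ->
  vlim (fun k => vscale (/ norm (vsub (y k) (x k))) (vsub (y k) (x k))) u ->
  (forall k, soc_polar (l k)) -> (forall k, dot (l k) (G (x k)) = 0) -> vlim l lb ->
  (forall k, adj (jac (x k)) (l k) = vsub (v k) (df (x k))) ->
  (forall k, f (y k) - dot (v k) (y k) <= f (x k) - dot (v k) (x k)
     + 1 / (2 * kappa) * (norm (vsub (y k) (x k)) * norm (vsub (y k) (x k)))) ->
  dot (adj (jac xbar) lb) u = 0 /\
  lb Fin.F1 * lorentz (fun i => dot (DG i xbar) u) = 0 /\
  quad (d2f xbar) u + hess lb u <= 1 / kappa.
Proof.
  intros Hkap HFx HFy Hx Hy Hne Hu Hpol Hcompl Hl Hst Hle.
  set (t := fun k => norm (vsub (y k) (x k))) in *.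
  assert (Ht : forall k, 0 < t k) by (intro; apply norm_vsub_pos, Hne).
  pose proof (norm_vsub_lim0 x y Hx Hy) as Ht0; change (is_lim_seq t 0) in Ht0.
  pose proof (taylor2_lim n f df d2f xbar x y t u f_C2 Hx Hy Ht Hu) as Tf.
  pose proof (pairing_taylor2_lim x y t u l lb Hx Hy Ht Hu Hl) as Tg.
  pose proof (is_lim_seq_plus' _ _ _ _ Tf Tg) as TL.
  set (e := fun k => - dot (l k) (G (y k))).
  assert (He0 : forall k, 0 <= e k).
  { intro k; pose proof (soc_polar_dot_le m _ _ (HFy k) (Hpol k)); unfold e; lra. }
  (* By stationarity the linear terms of [f] and of the pairing add up to the tilt
     [<v k, y k - x k>], so violated growth reads [e k <= b k t^2]. *)
  set (b := fun k => 1 / (2 * kappa) - ((f (y k) - f (x k) - dot (df (x k)) (vsub (y k) (x k))) / (t k * t k)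
     + (dot (l k) (G (y k)) - dot (l k) (G (x k)) - dot (adj (jac (x k)) (l k)) (vsub (y k) (x k))) / (t k * t k))).
  assert (Hb : is_lim_seq b (1 / (2 * kappa) - (quad (d2f xbar) u / 2 + hess lb u / 2))).
  { apply is_lim_seq_minus'; [apply is_lim_seq_const|exact TL]. }
  assert (Heb : forall k, e k / (t k * t k) <= b k).
  { intro k; specialize (Ht k); specialize (Hle k).
    assert (Htt : 0 < t k * t k) by nra.
    apply Rmult_le_reg_r with (t k * t k); [exact Htt|].
    replace (e k / (t k * t k) * (t k * t k)) with (e k) by (field; lra).
    unfold b; rewrite Hst, Hcompl, dot_sub_l, !dot_sub_r.
    replace ((1 / (2 * kappa) - ((f (y k) - f (x k) - (dot (df (x k)) (y k) - dot (df (x k)) (x k))) / (t k * t k) +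
       (dot (l k) (G (y k)) - 0 - (dot (v k) (y k) - dot (v k) (x k) - (dot (df (x k)) (y k) - dot (df (x k)) (x k)))) /
       (t k * t k))) * (t k * t k))
      with (1 / (2 * kappa) * (t k * t k) - (f (y k) - f (x k)) - dot (l k) (G (y k))
        + (dot (v k) (y k) - dot (v k) (x k))) by (field; lra).
    unfold e; fold (t k) in Hle; lra. }
  assert (Hett : forall k, 0 <= e k / (t k * t k)).
  { intro k; apply Rdiv_le_0_compat; [apply He0|specialize (Ht k); nra]. }
  split; [|split].
  - refine (is_lim_seq_eq _ _ _ (pairing_taylor1_lim x y t u l lb Hx Hy Ht Hu Hl Ht0) _).
    apply (is_lim_seq_squeeze0 _ (fun k => t k * b k)).
    + intro k; rewrite Hcompl; specialize (Ht k); specialize (Heb k); specialize (Hett k).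
      replace ((dot (l k) (G (y k)) - 0) / t k) with (- (t k * (e k / (t k * t k))))
        by (unfold e; field; lra).
      rewrite Rabs_Ropp, Rabs_right; [|apply Rle_ge; nra].
      apply Rmult_le_compat_l; lra.
    + evar_last; [apply is_lim_seq_mult'; [exact Ht0|exact Hb]|f_equal; ring].
  - set (p := fun k => vscale (/ t k) (vsub (G (y k)) (G (x k)))).
    assert (Hp : vlim p (fun i => dot (DG i xbar) u)) by now apply G_taylor1_lim.
    apply (is_lim_seq_eq (fun k => l k Fin.F1 * lorentz (p k))).
    + apply is_lim_seq_mult'; [apply Hl|].
      apply is_lim_seq_minus'; [|apply is_lim_seq_mult'; apply Hp].
      apply is_lim_seq_dot; intro i; apply (Hp (Fin.FS i)).
    (* The form is homogeneous of degree 2, so [soc_lorentz_gap] can be divided by [t^2]; the heads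
       of [G] tend to 0 and [b] stays bounded. *)
    + apply (is_lim_seq_squeeze0 _ (fun k => 2 * (G (y k) Fin.F1 + G (x k) Fin.F1) * b k)).
      * intro k; specialize (Ht k).
        replace (lorentz (p k)) with (/ (t k * t k) * lorentz (vsub (G (y k)) (G (x k)))).
        2:{ unfold lorentz, p.
            change (tl (vscale (/ t k) (vsub (G (y k)) (G (x k)))))
              with (vscale (/ t k) (tl (vsub (G (y k)) (G (x k))))).
            rewrite dot_scale_l, dot_scale_r; unfold vscale; field; lra. }
        assert (Hg : 0 <= 2 * (G (y k) Fin.F1 + G (x k) Fin.F1)).
        { specialize (HFx k); specialize (HFy k); unfold soc in *.
          pose proof (norm_nonneg m (tl (G (x k)))); pose proof (norm_nonneg m (tl (G (y k)))); lra. }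
        apply Rle_trans with (2 * (G (y k) Fin.F1 + G (x k) Fin.F1) * (e k / (t k * t k))).
        2:{ apply Rmult_le_compat_l; [exact Hg|apply Heb]. }
        replace (l k Fin.F1 * (/ (t k * t k) * lorentz (vsub (G (y k)) (G (x k)))))
          with (/ (t k * t k) * (l k Fin.F1 * lorentz (vsub (G (y k)) (G (x k))))) by ring.
        assert (0 < / (t k * t k)) by (apply Rinv_0_lt_compat; nra).
        rewrite Rabs_mult, (Rabs_right (/ _)) by lra.
        replace (2 * (G (y k) Fin.F1 + G (x k) Fin.F1) * (e k / (t k * t k)))
          with (/ (t k * t k) * (2 * (G (y k) Fin.F1 + G (x k) Fin.F1) * e k)) by (unfold Rdiv; ring).
        apply Rmult_le_compat_l; [lra|].
        apply soc_lorentz_gap; auto.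
      * evar_last.
        { apply is_lim_seq_mult'; [|exact Hb].
          apply is_lim_seq_mult'; [apply is_lim_seq_const|].
          apply is_lim_seq_plus'; [apply (G_lim y Hy Fin.F1)|apply (G_lim x Hx Fin.F1)]. }
        unfold vzero; f_equal; ring.
  - assert (H : 0 <= 1 / (2 * kappa) - (quad (d2f xbar) u / 2 + hess lb u / 2)).
    { apply (is_lim_seq_ge_const b); [exact Hb|]; intro k; specialize (Heb k); specialize (Hett k); lra. }
    replace (1 / (2 * kappa)) with (1 / kappa / 2) in H by (field; lra); lra.
Qed.
End Limits.

(** * Tilt stability *)

(** The slack [c |z - x|^2] is of second order and leaves the normal unchanged. It absorbs the
    proximal term in [stationary_points_below]; tilted minimizers use [c = 0]. *)
Lemma local_min_frechet_normal n (f : vec n -> R) (S : vec n -> Prop) x p v c d :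
  S x -> frechet_grad f x p -> 0 <= c -> 0 < d ->
  (forall z, S z -> norm (vsub z x) < d ->
     f x - dot v x <= f z - dot v z + c * (norm (vsub z x) * norm (vsub z x))) ->
  frechet_normal S x (vsub v p).
Proof.
  intros Sx Hp Hc Hd H; split; [exact Sx|]; intros e He.
  destruct (Hp (e / 2) ltac:(lra)) as [d1 [Hd1 H1]].
  assert (Hd2 : 0 < e / (2 * (c + 1))) by (apply Rdiv_lt_0_compat; lra).
  exists (Rmin (Rmin d d1) (e / (2 * (c + 1)))); split; [repeat apply Rmin_glb_lt; assumption|].
  intros y Sy Hy.
  pose proof (Rmin_l (Rmin d d1) (e / (2 * (c + 1)))); pose proof (Rmin_r (Rmin d d1) (e / (2 * (c + 1)))).
  pose proof (Rmin_l d d1); pose proof (Rmin_r d d1).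
  specialize (H y Sy ltac:(lra)); specialize (H1 y ltac:(lra)).
  apply Rabs_le_between in H1.
  rewrite dot_sub_l; rewrite (dot_sub_r n y x v).
  pose proof (norm_nonneg n (vsub y x)) as Hn.
  assert (Hcn : c * norm (vsub y x) <= e / 2).
  { apply Rle_trans with ((c + 1) * (e / (2 * (c + 1)))); [nra|right; field; lra]. }
  nra.
Qed.

Lemma norm_vsub_sq n (x y z : vec n) :
  norm (vsub z y) * norm (vsub z y) =
  norm (vsub x y) * norm (vsub x y) + 2 * dot (vsub x y) (vsub z x) + norm (vsub z x) * norm (vsub z x).
Proof.
  rewrite !norm_sq; replace (vsub z y) with (vadd (vsub x y) (vsub z x))
    by (apply functional_extensionality; intro; unfold vadd, vsub; ring).
  rewrite dot_add_l, !dot_add_r, (dot_comm n (vsub z x) (vsub x y)); ring.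
Qed.

Section Tilt.
Variables (n m : nat) (f : vec n -> R) (df : vec n -> vec n) (d2f : vec n -> mat n).
Variables (G : vec n -> vec (S m)) (DG : Fin.t (S m) -> vec n -> vec n)
  (D2G : Fin.t (S m) -> vec n -> mat n) (xbar : vec n) (sigma kappa : R).
Hypothesis f_C2 : C2_near f df d2f xbar.
Hypothesis G_C2 : forall i, C2_near (fun z => G z i) (DG i) (D2G i) xbar.
Hypothesis G_xbar : G xbar = vzero.

Let feas (y : vec n) : Prop := soc (G y).
Let jac (x : vec n) : Fin.t (S m) -> vec n := fun i => DG i x.
Let hess (l : vec (S m)) (u : vec n) : R := sumF (S m) (fun i => l i * quad (D2G i xbar) u).
Let xs : vec n := vopp (df xbar).

Hypothesis stationary : limiting_normal feas xbar xs.
Hypothesis sigma_pos : 0 < sigma.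
Hypothesis kappa_pos : 0 < kappa.
Hypothesis subregular : exists r, 0 < r /\ forall z q e, norm (vsub z xbar) < r -> soc q -> 0 < e ->
  exists y, soc (G y) /\ norm (vsub z y) <= sigma * norm (vsub (G z) q) + e.
(** The assumption of the theorem in vector form. As [g xbar = 0], the normal cone is the polar cone
    and the curvature term is zero, which leaves [hess]. *)
Hypothesis second_order : forall l v u,
  critical feas xbar xs v -> norm v = 1 -> soc_polar l -> adj (jac xbar) l = xs ->
  (forall mu, soc_polar mu -> adj (jac xbar) mu = xs -> hess mu v <= hess l v) ->
  norm u = 1 -> dot (adj (jac xbar) l) u = 0 ->
  l Fin.F1 * lorentz (fun i => dot (DG i xbar) u) = 0 ->
  1 / kappa < quad (d2f xbar) u + hess l u.

Lemma feas_xbar : feas xbar.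
Proof. unfold feas; rewrite G_xbar; apply soc_zero. Qed.

Lemma C2_region : exists r, 0 < r /\ forall z, norm (vsub z xbar) < r ->
  C2_near f df d2f z /\ forall i, C2_near (fun y => G y i) (DG i) (D2G i) z.
Proof.
  destruct (C2_near_shrink n f df d2f xbar f_C2) as [r1 [Hr1 H1]].
  destruct (common_radius (S m) (fun i r => forall z, norm (vsub z xbar) < r ->
     C2_near (fun y => G y i) (DG i) (D2G i) z)) as [r2 [Hr2 H2]].
  - intros i r s H Hs z Hz; apply H; lra.
  - intro i; apply C2_near_shrink, G_C2.
  - exists (Rmin r1 r2); split; [now apply Rmin_glb_lt|]; intros z Hz.
    pose proof (Rmin_l r1 r2); pose proof (Rmin_r r1 r2).
    split; [apply H1; lra|intro i; apply H2; lra].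
Qed.

Lemma multiplier_near : exists r, 0 < r /\ forall x p, norm (vsub x xbar) < r ->
  frechet_normal feas x p -> exists l, soc_polar l /\ dot l (G x) = 0 /\
    adj (jac x) l = p /\ norm l <= 2 * sigma * norm p.
Proof.
  destruct C2_region as [r1 [Hr1 H1]]; destruct subregular as [r2 [Hr2 H2]].
  set (r := Rmin r1 r2 / 2).
  assert (Hr : 0 < r) by (pose proof (Rmin_glb_lt _ _ _ Hr1 Hr2); unfold r; lra).
  exists r; split; [exact Hr|]; intros x p Hx Hp.
  pose proof (Rmin_l r1 r2); pose proof (Rmin_r r1 r2).
  assert (HT : forall z, norm (vsub z x) < r -> norm (vsub z xbar) < r1 /\ norm (vsub z xbar) < r2).
  { intros z Hz; pose proof (norm_vsub_triangle n z x xbar); unfold r in *; lra. }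
  destruct (normal_multiplier n (S m) soc (soc_convex m) (soc_closed m) G DG D2G x p r sigma
    Hr sigma_pos) as [l [Hl1 [Hl2 Hl3]]].
  - intros z i Hz; apply H1, HT, Hz.
  - intros z q e Hz Hq He; apply H2; [apply HT, Hz|exact Hq|exact He].
  - exact Hp.
  - exists l; destruct (soc_normal m l (G x)) as [A B]; [apply Hp|exact Hl1|].
    repeat split; assumption.
Qed.

(** Stationarity is in the limiting sense, so the multiplier rule is applied to the Fréchet normals
    at the approximating points and passed to the limit. *)
Lemma base_multiplier : exists l, soc_polar l /\ adj (jac xbar) l = xs.
Proof.
  destruct stationary as [x [v [HF [Hx [Hv HN]]]]].
  apply vcv_vlim in Hx; apply vcv_vlim in Hv.
  destruct multiplier_near as [r [Hr HM]].
  destruct (filter_and _ _ (vlim_eventually_near n x xbar r Hx Hr)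
    (is_lim_seq_eventually_lt _ _ (norm xs + 1) (is_lim_seq_norm n v _ Hv) ltac:(lra))) as [K HK].
  destruct (choice _ (fun k => HM (x (K + k)%nat) (v (K + k)%nat)
    (proj1 (HK (K + k)%nat ltac:(lia))) (HN _))) as [l Hl].
  destruct (bounded_vextract (S m) l (2 * sigma * (norm xs + 1))) as [phi [lb [Hphi Hlb]]].
  { intro k; destruct (Hl k) as (_ & _ & _ & B); eapply Rle_trans; [exact B|].
    destruct (HK (K + k)%nat ltac:(lia)) as [_ B']; apply Rmult_le_compat_l; lra. }
  assert (Hpsi : forall k, (k <= K + phi k)%nat) by (intro k; specialize (Hphi k); lia).
  exists lb; split.
  - apply (soc_polar_closed m (fun k => l (phi k))); [intro; apply Hl|exact Hlb].
  - apply functional_extensionality; intro j.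
    apply (is_lim_seq_eq (fun k => v (K + phi k)%nat j)).
    + apply is_lim_seq_ext with (fun k => adj (jac (x (K + phi k)%nat)) (l (phi k)) j).
      { intro k; destruct (Hl (phi k)) as (_ & _ & E & _); now rewrite E. }
      apply (adj_lim n m G DG D2G xbar G_C2 (fun k => x (K + phi k)%nat)); [|exact Hlb].
      exact (vlim_extract n (fun k => (K + phi k)%nat) x xbar Hpsi Hx).
    + exact (vlim_extract n (fun k => (K + phi k)%nat) v xs Hpsi Hv j).
Qed.

Lemma vlim_radius (x : nat -> vec n) r :
  (forall k, norm (vsub (x k) xbar) < r * / INR (S k)) -> vlim x xbar.
Proof.
  intro H; apply vlim_of_norm.
  apply (is_lim_seq_squeeze0 _ (fun k => r * / INR (S k))).
  - intro k; rewrite Rabs_right by apply Rle_ge, norm_nonneg; apply Rlt_le, H.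
  - evar_last; [apply is_lim_seq_mult'; [apply is_lim_seq_const|apply is_lim_seq_inv_S]|f_equal; ring].
Qed.

Lemma radius_bounds r k : 0 < r -> 0 < r * / INR (S k) <= r.
Proof.
  intro Hr; pose proof (inv_S_pos k).
  assert (/ INR (S k) <= 1).
  { rewrite <- Rinv_1; apply Rinv_le_contravar; [lra|]; rewrite S_INR; pose proof (pos_INR k); lra. }
  split; nra.
Qed.

Lemma direction_extract (x y : nat -> vec n) :
  (forall k, y k <> x k) -> exists phi u, (forall k, (k <= phi k)%nat) /\ norm u = 1 /\
    vlim (fun k => vscale (/ norm (vsub (y (phi k)) (x (phi k)))) (vsub (y (phi k)) (x (phi k)))) u.
Proof.
  intro Hne.
  assert (H1 : forall k, norm (vscale (/ norm (vsub (y k) (x k))) (vsub (y k) (x k))) = 1)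
    by (intro k; apply norm_normalized, norm_vsub_pos, Hne).
  destruct (bounded_vextract n (fun k => vscale (/ norm (vsub (y k) (x k))) (vsub (y k) (x k))) 1)
    as [phi [u [Hphi Hu]]]; [intro k; right; apply H1|].
  exists phi, u; split; [exact Hphi|split; [|exact Hu]].
  apply (is_lim_seq_eq _ _ _ (is_lim_seq_norm n _ _ Hu)).
  apply is_lim_seq_ext with (fun _ => 1); [intro k; symmetry; apply H1|apply is_lim_seq_const].
Qed.

(** A multiplier at [xbar] turns the limiting normal into a first-order optimality condition:
    feasibility gives [<l, G z> <= 0], hence [<xs, u> <= 0] for every limit [u] of feasible
    directions. It keeps the proximal points of [stationary_points_below] away from [xbar]. *)
Lemma first_order_lower e : 0 < e -> exists d, 0 < d /\ forall z, feas z ->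
  norm (vsub z xbar) < d -> f xbar - e * norm (vsub z xbar) <= f z.
Proof.
  intro He; apply NNPP; intro N.
  assert (H : forall k : nat, exists z, feas z /\ norm (vsub z xbar) < 1 * / INR (S k) /\
    f z < f xbar - e * norm (vsub z xbar)).
  { intro k; apply NNPP; intro M; apply N; exists (1 * / INR (S k)).
    split; [apply radius_bounds; lra|]; intros z Hz Hz1; apply Rnot_lt_le; intro L; apply M; eauto. }
  destruct (choice _ H) as [z Hz]; clear H N.
  assert (Hlim : vlim z xbar) by (apply (vlim_radius z 1); intro k; apply Hz).
  assert (Hne : forall k, z k <> xbar).
  { intros k E; destruct (Hz k) as (_ & _ & L); rewrite E, norm_vsub_diag in L; lra. }
  destruct (direction_extract (fun _ => xbar) z Hne) as [phi [u [Hphi [_ Hu]]]].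
  apply (vlim_extract n phi) in Hlim; [|exact Hphi].
  set (s := fun k => norm (vsub (z (phi k)) xbar)) in *.
  assert (Hs : forall k, 0 < s k) by (intro; apply norm_vsub_pos, Hne).
  pose proof (norm_vsub_lim0 n xbar (fun _ => xbar) _ (vlim_const n xbar) Hlim) as Hs0.
  change (is_lim_seq s 0) in Hs0.
  destruct base_multiplier as [l [Hl El]].
  pose proof (taylor1_lim n f df d2f xbar (fun _ => xbar) (fun k => z (phi k)) s u f_C2
    (vlim_const n xbar) Hlim Hs Hs0 Hu) as Tf.
  pose proof (pairing_taylor1_lim n m G DG D2G xbar G_C2 (fun _ => xbar) (fun k => z (phi k)) s u
    (fun _ => l) l (vlim_const n xbar) Hlim Hs Hu (vlim_const _ l) Hs0) as Tg.
  assert (A : dot (df xbar) u <= - e).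
  { apply (is_lim_seq_le_const _ _ _ Tf); intro k; destruct (Hz (phi k)) as (_ & _ & L).
    specialize (Hs k); fold (s k) in L; apply Rmult_le_reg_r with (s k); [exact Hs|].
    unfold Rdiv; rewrite Rmult_assoc, Rinv_l; lra. }
  assert (B : dot (adj (jac xbar) l) u <= 0).
  { apply (is_lim_seq_le_const _ _ _ Tg); intro k; cbv beta; rewrite G_xbar, dot_zero_r.
    specialize (Hs k); apply Rmult_le_reg_r with (s k); [exact Hs|].
    unfold Rdiv; rewrite Rmult_assoc, Rinv_l by lra.
    pose proof (soc_polar_dot_le m l _ (proj1 (Hz (phi k))) Hl); lra. }
  rewrite El in B; unfold xs in B; rewrite dot_opp_l in B; lra.
Qed.

Lemma feasible_ball_minimizer (F : vec n -> R) r rho :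
  (forall z, norm (vsub z xbar) < r -> C2_near f df d2f z /\
     forall i, C2_near (fun y => G y i) (DG i) (D2G i) z) ->
  0 < rho < r ->
  (forall z (x : nat -> vec n), norm (vsub z xbar) < r -> vlim x z ->
     is_lim_seq (fun k => F (x k)) (F z)) ->
  exists x, (feas x /\ norm (vsub x xbar) <= rho) /\
    forall y, feas y /\ norm (vsub y xbar) <= rho -> F x <= F y.
Proof.
  intros HC Hrho HF; apply minimizer_exists.
  - exists xbar; split; [apply feas_xbar|rewrite norm_vsub_diag; lra].
  - intros x Hx.
    destruct (bounded_vextract n x (rho + norm xbar)) as [phi [z [Hphi Hz]]].
    { intro k; apply near_bounded, Hx. }
    assert (Hzr : norm (vsub z xbar) <= rho).
    { apply (is_lim_seq_le_const (fun k => norm (vsub (x (phi k)) xbar))).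
      - apply is_lim_seq_norm, vlim_sub; [exact Hz|apply vlim_const].
      - intro k; apply Hx. }
    exists phi, z; split; [exact Hphi|split; [split; [|exact Hzr]|apply HF; [lra|exact Hz]]].
    apply (soc_closed m (fun k => G (x (phi k)))); [intro; apply Hx|].
    intro i; apply (C2_near_lim n (fun y => G y i) (DG i) (D2G i) z); [apply HC; lra|exact Hz].
Qed.

(* Stationary points other than [xbar] are produced by adding [(e/t) |z - y|^2] to the objective,
   with [t = |y - xbar|]; they supply the multipliers at [xbar] that are maximal in some
   critical direction, whose existence is not clear a priori. *)
Lemma stationary_points_below e :
  (forall d, 0 < d -> exists y, feas y /\ norm (vsub y xbar) < d /\ y <> xbar /\ f y <= f xbar) ->
  0 < e -> exists x p, feas x /\ x <> xbar /\ norm (vsub x xbar) < e /\ f x <= f xbar /\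
    norm p <= e /\ frechet_normal feas x (vsub p (df x)).
Proof.
  intros Hbad He.
  destruct C2_region as [r [Hr HC]].
  (* With 1/8, minimality in the ball of radius [2 t] gives [c |x - y|^2 <= e t / 4 = c t^2 / 4]. *)
  destruct (first_order_lower (e / 8) ltac:(lra)) as [d [Hd Hlow]].
  set (rho := Rmin (Rmin r d) e).
  assert (Hrho : 0 < rho <= r /\ rho <= d /\ rho <= e).
  { pose proof (Rmin_l (Rmin r d) e); pose proof (Rmin_r (Rmin r d) e).
    pose proof (Rmin_l r d); pose proof (Rmin_r r d).
    pose proof (Rmin_glb_lt _ _ _ (Rmin_glb_lt _ _ _ Hr Hd) He); unfold rho; lra. }
  destruct (Hbad (rho / 3) ltac:(lra)) as [y [Fy [Hy [Hne Hfy]]]].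
  set (t := norm (vsub y xbar)) in *.
  assert (Ht : 0 < t) by (apply norm_vsub_pos, Hne).
  assert (Hc : 0 < e / t) by (apply Rdiv_lt_0_compat; assumption).
  assert (Hct : e / t * t = e) by (field; lra).
  set (c := e / t) in *; clearbody c.
  destruct (feasible_ball_minimizer (fun z => f z + c * (norm (vsub z y) * norm (vsub z y)))
    r (2 * t) HC ltac:(lra)) as [x [[Fx Hx] Hmin]].
  { intros z xk Hz Hxk; apply is_lim_seq_plus'.
    - apply (C2_near_lim n f df d2f z); [apply HC, Hz|exact Hxk].
    - apply is_lim_seq_mult'; [apply is_lim_seq_const|].
      assert (P : is_lim_seq (fun k => norm (vsub (xk k) y)) (norm (vsub z y)))
        by (apply is_lim_seq_norm, vlim_sub; [exact Hxk|apply vlim_const]).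
      now apply is_lim_seq_mult'. }
  pose proof (Hmin y ltac:(split; [exact Fy|fold t; lra])) as Hxy.
  rewrite norm_vsub_diag in Hxy.
  specialize (Hlow x Fx ltac:(lra)) as Hlx.
  pose proof (norm_nonneg n (vsub x y)) as Hn0.
  (* This one bound yields [x <> xbar], [|x - xbar| <= 3 t / 2 < 2 t] and
     [|p| = 2 c |x - y| <= e]. *)
  assert (Hxyt : norm (vsub x y) <= t / 2).
  { assert (A : c * (norm (vsub x y) * norm (vsub x y)) <= c * (t / 2 * (t / 2))) by nra.
    apply Rmult_le_reg_l in A; [|exact Hc]; nra. }
  pose proof (norm_vsub_triangle n x y xbar) as T1; fold t in T1.
  pose proof (norm_vsub_triangle n y x xbar) as T2; rewrite (norm_vsub_sym n y x) in T2; fold t in T2.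
  exists x, (vscale (- (2 * c)) (vsub x y)); split; [exact Fx|].
  split; [intro E; assert (norm (vsub x xbar) = 0) by (rewrite E; apply norm_vsub_diag); lra|].
  split; [lra|]; split; [nra|]; split; [rewrite norm_scale, Rabs_left1 by lra; nra|].
  apply (local_min_frechet_normal n f feas x (df x) _ c (t / 2));
    [exact Fx|apply (C2_near_here n f df d2f), HC; lra|lra|lra|].
  intros z Fz Hz.
  pose proof (norm_vsub_triangle n z x xbar).
  pose proof (Hmin z ltac:(split; [exact Fz|lra])) as Hzx.
  rewrite (norm_vsub_sq n x y z) in Hzx.
  assert (E : dot (vscale (- (2 * c)) (vsub x y)) z - dot (vscale (- (2 * c)) (vsub x y)) x
     = - (2 * c) * dot (vsub x y) (vsub z x)) by (rewrite <- dot_sub_r, dot_scale_l; reflexivity).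
  lra.
Qed.

(** Extraction first of the direction, then of the multipliers. [l] is indexed along the composed
    extraction: [l k] is a multiplier at [x (phi k)]. *)
Lemma multipliers_extract (x p : nat -> vec n) r :
  (forall z q, norm (vsub z xbar) < r -> frechet_normal feas z q -> exists l, soc_polar l /\
     dot l (G z) = 0 /\ adj (jac z) l = q /\ norm l <= 2 * sigma * norm q) ->
  (forall k, feas (x k)) -> (forall k, x k <> xbar) -> (forall k, norm (vsub (x k) xbar) < r) ->
  vlim x xbar -> vlim p vzero -> (forall k, frechet_normal feas (x k) (vsub (p k) (df (x k)))) ->
  exists phi v l lb, (forall k, (k <= phi k)%nat) /\
    (forall k, soc_polar (l k) /\ dot (l k) (G (x (phi k))) = 0 /\
       adj (jac (x (phi k))) (l k) = vsub (p (phi k)) (df (x (phi k)))) /\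
    vlim l lb /\
    vlim (fun k => vscale (/ norm (vsub (x (phi k)) xbar)) (vsub (x (phi k)) xbar)) v /\
    critical feas xbar xs v /\ norm v = 1 /\ soc_polar lb /\ adj (jac xbar) lb = xs /\
    forall mu, soc_polar mu -> adj (jac xbar) mu = xs -> hess mu v <= hess lb v.
Proof.
  intros HM Fx Hne Hxr Hx Hp HN.
  destruct (direction_extract (fun _ => xbar) x Hne) as [phi [v [Hphi [_ Hv]]]].
  assert (Hxs : vlim (fun k => vsub (p (phi k)) (df (x (phi k)))) xs).
  { replace xs with (vsub (@vzero n) (df xbar))
      by (apply functional_extensionality; intro; unfold xs, vsub, vopp, vzero; ring).
    apply vlim_sub; [exact (vlim_extract n phi p vzero Hphi Hp)|].
    apply (C2_near_grad_lim n f df d2f xbar (fun k => x (phi k)) f_C2).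
    exact (vlim_extract n phi x xbar Hphi Hx). }
  (* From [K] on the normals are shorter than [|xs| + 1], which bounds their multipliers
     uniformly. *)
  destruct (is_lim_seq_eventually_lt _ _ (norm xs + 1) (is_lim_seq_norm n _ _ Hxs) ltac:(lra)) as [K HK].
  destruct (choice _ (fun k => HM (x (phi (K + k)%nat)) _ (Hxr _) (HN _))) as [l Hl].
  destruct (bounded_vextract (S m) l (2 * sigma * (norm xs + 1))) as [psi [lb [Hpsi Hlb]]].
  { intro k; destruct (Hl k) as (_ & _ & _ & B); eapply Rle_trans; [exact B|].
    specialize (HK (K + k)%nat ltac:(lia)); apply Rmult_le_compat_l; lra. }
  assert (Hchi : forall k, (k <= K + psi k)%nat) by (intro k; specialize (Hpsi k); lia).
  exists (fun k => phi (K + psi k)%nat), v, (fun k => l (psi k)), lb.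
  assert (Hphi' : forall k, (k <= phi (K + psi k))%nat).
  { intro k; specialize (Hchi k); specialize (Hphi (K + psi k)%nat); lia. }
  assert (Hv' : vlim (fun k => vscale (/ norm (vsub (x (phi (K + psi k)%nat)) xbar))
      (vsub (x (phi (K + psi k)%nat)) xbar)) v).
  { exact (vlim_extract n (fun k => (K + psi k)%nat) _ v Hchi Hv). }
  split; [exact Hphi'|].
  split; [intro k; destruct (Hl (psi k)) as (A & B & C' & _); auto|].
  split; [exact Hlb|]; split; [exact Hv'|].
  apply (directional_multiplier_lim n m G DG D2G xbar G_C2 G_xbar
    (fun k => x (phi (K + psi k)%nat)) (fun k => l (psi k)) xs v lb (2 * sigma)).
  - intro k; apply Fx.
  - intro k; apply Hne.
  - exact (vlim_extract n (fun k => phi (K + psi k)%nat) x xbar Hphi' Hx).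
  - exact Hv'.
  - intro k; apply Hl.
  - intro k; apply Hl.
  - exact Hlb.
  - replace (fun k => adj (fun i => DG i (x (phi (K + psi k)%nat))) (l (psi k)))
      with (fun k => vsub (p (phi (K + psi k)%nat)) (df (x (phi (K + psi k)%nat)))).
    + exact (vlim_extract n (fun k => (K + psi k)%nat) _ xs Hchi Hxs).
    + apply functional_extensionality; intro k; symmetry; apply Hl.
  - intro k; destruct (Hl (psi k)) as (_ & _ & E & B).
    change (norm (l (psi k)) <= 2 * sigma * norm (adj (jac (x (phi (K + psi k)%nat))) (l (psi k)))).
    rewrite E; exact B.
Qed.

Lemma strict_local_minimizer : exists rho, 0 < rho /\ forall y, feas y ->
  norm (vsub y xbar) < rho -> y <> xbar -> f xbar < f y.
Proof.
  apply NNPP; intro N.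
  assert (Hbad : forall d, 0 < d ->
    exists y, feas y /\ norm (vsub y xbar) < d /\ y <> xbar /\ f y <= f xbar).
  { intros d Hd; apply NNPP; intro M; apply N; exists d; split; [exact Hd|].
    intros y Fy Hy Hne; apply Rnot_le_lt; intro L; apply M; eauto. }
  destruct multiplier_near as [r [Hr HM]].
  destruct (choice _ (fun k => stationary_points_below (r * / INR (S k)) Hbad
    (proj1 (radius_bounds r k Hr)))) as [x Hx].
  destruct (choice _ Hx) as [p H]; clear Hx.
  assert (Hxlim : vlim x xbar) by (apply (vlim_radius x r); intro k; apply H).
  destruct (multipliers_extract x p r HM) as (phi & v & l & lb & Hphi & _ & _ & Hv & Hcrit & Hv1 &
    Hlb & Elb & Hmax).
  - intro k; apply H.
  - intro k; apply H.
  - intro k; destruct (H k) as (_ & _ & A & _); pose proof (radius_bounds r k Hr); lra.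
  - exact Hxlim.
  - apply vlim_of_norm, (is_lim_seq_squeeze0 _ (fun k => r * / INR (S k))).
    + intro k; rewrite Rabs_right by apply Rle_ge, norm_nonneg.
      replace (vsub (p k) vzero) with (p k)
        by (apply functional_extensionality; intro; unfold vsub, vzero; ring).
      apply H.
    + evar_last; [apply is_lim_seq_mult'; [apply is_lim_seq_const|apply is_lim_seq_inv_S]|f_equal; ring].
  - intro k; apply H.
  (* Growth fails at [xbar] itself with zero tilt. The critical direction [v] also plays the part of
     [u], and the constant multiplier [lb] is already known to be directional. *)
  - destruct (growth_violation_lim n m f df d2f G DG D2G xbar f_C2 G_C2 G_xbar kappa (fun _ => xbar)
      (fun k => x (phi k)) (fun _ => vzero) (fun _ => lb) v lb kappa_pos) as [A [B C]].
    + intro; apply feas_xbar.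
    + intro k; apply H.
    + apply vlim_const.
    + now apply vlim_extract.
    + intro k; apply H.
    + exact Hv.
    + intro; exact Hlb.
    + intro; rewrite G_xbar; apply dot_zero_r.
    + apply vlim_const.
    + intro k; change (adj (jac xbar) lb = vsub vzero (df xbar)); rewrite Elb.
      apply functional_extensionality; intro; unfold xs, vsub, vopp, vzero; ring.
    + intro k; rewrite !dot_zero_l; destruct (H (phi k)) as (_ & _ & _ & L & _).
      assert (0 < 1 / (2 * kappa)) by (apply Rdiv_lt_0_compat; lra).
      pose proof (norm_nonneg n (vsub (x (phi k)) xbar)).
      assert (0 <= norm (vsub (x (phi k)) xbar) * norm (vsub (x (phi k)) xbar)) by nra.
      nra.
    + pose proof (second_order lb v v Hcrit Hv1 Hlb Elb Hmax Hv1 A B) as P; unfold hess in P; lra.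
Qed.

(** Two directions occur in the limit: [d], from [xbar] to [x], selects the multiplier, and [u],
    from [x] to [y], is the one tested in the second-order condition. The first requires
    [x <> xbar]. *)
Lemma uniform_growth : exists rho, 0 < rho /\ forall v x y, norm v < rho ->
  norm (vsub x xbar) < rho -> norm (vsub y xbar) < rho -> feas x -> feas y -> x <> xbar ->
  frechet_normal feas x (vsub v (df x)) ->
  f x - dot v x + 1 / (2 * kappa) * (norm (vsub y x) * norm (vsub y x)) <= f y - dot v y.
Proof.
  apply NNPP; intro N.
  destruct multiplier_near as [r [Hr HM]].
  assert (H : forall k : nat, exists t : vec n * vec n * vec n,
    norm (fst (fst t)) < r * / INR (S k) /\ norm (vsub (snd (fst t)) xbar) < r * / INR (S k) /\
    norm (vsub (snd t) xbar) < r * / INR (S k) /\ feas (snd (fst t)) /\ feas (snd t) /\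
    snd (fst t) <> xbar /\ frechet_normal feas (snd (fst t)) (vsub (fst (fst t)) (df (snd (fst t)))) /\
    f (snd t) - dot (fst (fst t)) (snd t) < f (snd (fst t)) - dot (fst (fst t)) (snd (fst t))
      + 1 / (2 * kappa) * (norm (vsub (snd t) (snd (fst t))) * norm (vsub (snd t) (snd (fst t))))).
  { intro k; apply NNPP; intro M; apply N; exists (r * / INR (S k)).
    split; [now apply radius_bounds|]; intros v x y H1 H2 H3 H4 H5 H6 H7.
    apply Rnot_lt_le; intro L; apply M; exists (v, x, y); simpl; tauto. }
  destruct (choice _ H) as [t Ht]; clear H N.
  set (v := fun k => fst (fst (t k))); set (x := fun k => snd (fst (t k))); set (y := fun k => snd (t k)).
  assert (H : forall k, norm (v k) < r * / INR (S k) /\ norm (vsub (x k) xbar) < r * / INR (S k) /\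
    norm (vsub (y k) xbar) < r * / INR (S k) /\ feas (x k) /\ feas (y k) /\ x k <> xbar /\
    frechet_normal feas (x k) (vsub (v k) (df (x k))) /\
    f (y k) - dot (v k) (y k) < f (x k) - dot (v k) (x k)
      + 1 / (2 * kappa) * (norm (vsub (y k) (x k)) * norm (vsub (y k) (x k)))) by exact Ht.
  clear Ht; clearbody v x y; clear t.
  assert (Hx : vlim x xbar) by (apply (vlim_radius x r); intro k; apply H).
  assert (Hy : vlim y xbar) by (apply (vlim_radius y r); intro k; apply H).
  assert (Hv : vlim v vzero).
  { apply vlim_of_norm, (is_lim_seq_squeeze0 _ (fun k => r * / INR (S k))).
    - intro k; rewrite Rabs_right by apply Rle_ge, norm_nonneg.
      replace (vsub (v k) vzero) with (v k)
        by (apply functional_extensionality; intro; unfold vsub, vzero; ring).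
      apply Rlt_le, H.
    - evar_last; [apply is_lim_seq_mult'; [apply is_lim_seq_const|apply is_lim_seq_inv_S]|f_equal; ring]. }
  assert (Hne : forall k, y k <> x k).
  { intros k E; destruct (H k) as (_ & _ & _ & _ & _ & _ & _ & L).
    rewrite E, norm_vsub_diag in L; lra. }
  destruct (multipliers_extract x v r HM) as (phi & d & l & lb & Hphi & Hl & Hlim & _ & Hcrit & Hd1 &
    Hlb & Elb & Hmax).
  - intro k; apply H.
  - intro k; apply H.
  - intro k; destruct (H k) as (_ & A & _); pose proof (radius_bounds r k Hr); lra.
  - exact Hx.
  - exact Hv.
  - intro k; apply H.
  - destruct (direction_extract (fun k => x (phi k)) (fun k => y (phi k)) (fun k => Hne _))
      as [psi [u [Hpsi [Hu1 Hu]]]].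
    assert (Hchi : forall k, (k <= phi (psi k))%nat).
    { intro k; specialize (Hpsi k); specialize (Hphi (psi k)); lia. }
    destruct (growth_violation_lim n m f df d2f G DG D2G xbar f_C2 G_C2 G_xbar kappa
      (fun k => x (phi (psi k))) (fun k => y (phi (psi k))) (fun k => v (phi (psi k)))
      (fun k => l (psi k)) u lb kappa_pos) as [A [B C]].
    + intro k; apply H.
    + intro k; apply H.
    + exact (vlim_extract n (fun k => phi (psi k)) x xbar Hchi Hx).
    + exact (vlim_extract n (fun k => phi (psi k)) y xbar Hchi Hy).
    + intro k; apply Hne.
    + exact Hu.
    + intro k; apply Hl.
    + intro k; apply Hl.
    + exact (vlim_extract (S m) psi l lb Hpsi Hlim).
    + intro k; apply Hl.
    + intro k; apply Rlt_le, H.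
    + pose proof (second_order lb d u Hcrit Hd1 Hlb Elb Hmax Hu1 A B) as P; unfold hess in P; lra.
Qed.

(** A limit of minimizers on the sphere, as the tilts tend to 0, would be a feasible point at
    distance [gamma] with value at most [f xbar]. *)
Lemma minimizers_interior gamma : 0 < gamma ->
  (forall z, norm (vsub z xbar) <= gamma -> C2_near f df d2f z /\
     forall i, C2_near (fun y => G y i) (DG i) (D2G i) z) ->
  (forall y, feas y -> norm (vsub y xbar) <= gamma -> y <> xbar -> f xbar < f y) ->
  exists eps, 0 < eps /\ forall v x, norm v < eps -> Mgamma f feas xbar gamma v x ->
    norm (vsub x xbar) < gamma.
Proof.
  intros Hg HC Hmin; apply NNPP; intro N.
  assert (H : forall k : nat, exists t : vec n * vec n, norm (fst t) < / INR (S k) /\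
    Mgamma f feas xbar gamma (fst t) (snd t) /\ norm (vsub (snd t) xbar) = gamma).
  { intro k; apply NNPP; intro M; apply N; exists (/ INR (S k)); split; [apply inv_S_pos|].
    intros v x Hv Hx; apply Rnot_le_lt; intro L; apply M; exists (v, x); simpl.
    split; [exact Hv|split; [exact Hx|]]; destruct Hx as (_ & B & _); lra. }
  destruct (choice _ H) as [t Ht]; clear H N.
  destruct (bounded_vextract n (fun k => snd (t k)) (gamma + norm xbar)) as [phi [z [Hphi Hz]]].
  { intro k; apply near_bounded; right; apply Ht. }
  assert (Hzg : norm (vsub z xbar) = gamma).
  { apply (is_lim_seq_eq (fun k => norm (vsub (snd (t (phi k))) xbar))).
    - apply is_lim_seq_norm, vlim_sub; [exact Hz|apply vlim_const].
    - apply is_lim_seq_ext with (fun _ => gamma); [intro k; symmetry; apply Ht|apply is_lim_seq_const]. }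
  assert (Fz : feas z).
  { apply (soc_closed m (fun k => G (snd (t (phi k))))); [intro k; apply Ht|].
    intro i; apply (C2_near_lim n (fun y => G y i) (DG i) (D2G i) z); [apply HC; lra|exact Hz]. }
  assert (Hv : vlim (fun k => fst (t (phi k))) vzero).
  { apply (vlim_extract n phi (fun k => fst (t k)) vzero Hphi).
    apply vlim_of_norm, (is_lim_seq_squeeze0 _ (fun k => / INR (S k))); [|apply is_lim_seq_inv_S].
    intro k; rewrite Rabs_right by apply Rle_ge, norm_nonneg.
    replace (vsub (fst (t k)) vzero) with (fst (t k))
      by (apply functional_extensionality; intro; unfold vsub, vzero; ring).
    apply Rlt_le, Ht. }
  assert (Hle : f z - dot vzero z <= f xbar - dot vzero xbar).
  { apply (is_lim_seq_le_real (fun k => f (snd (t (phi k))) - dot (fst (t (phi k))) (snd (t (phi k))))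
      (fun k => f xbar - dot (fst (t (phi k))) xbar)).
    - intro k; destruct (Ht (phi k)) as (_ & (_ & _ & M) & _); apply M; [apply feas_xbar|].
      rewrite norm_vsub_diag; lra.
    - apply is_lim_seq_minus'; [|now apply is_lim_seq_dot].
      apply (C2_near_lim n f df d2f z); [apply HC; lra|exact Hz].
    - apply is_lim_seq_minus'; [apply is_lim_seq_const|].
      apply is_lim_seq_dot; [exact Hv|apply vlim_const]. }
  rewrite !dot_zero_l in Hle.
  assert (Hne : z <> xbar) by (intro E; rewrite E, norm_vsub_diag in Hzg; lra).
  specialize (Hmin z Fz ltac:(lra) Hne); lra.
Qed.

(** The two halves add up to [|x1 - x2|^2 / kappa <= <v1 - v2, x1 - x2>], which gives exactly the
    modulus [kappa]. *)
Lemma growth_lipschitz x1 x2 v1 v2 :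
  f x1 - dot v1 x1 + 1 / (2 * kappa) * (norm (vsub x2 x1) * norm (vsub x2 x1)) <= f x2 - dot v1 x2 ->
  f x2 - dot v2 x2 + 1 / (2 * kappa) * (norm (vsub x1 x2) * norm (vsub x1 x2)) <= f x1 - dot v2 x1 ->
  norm (vsub x1 x2) <= kappa * norm (vsub v1 v2).
Proof.
  intros H1 H2; rewrite (norm_vsub_sym n x2 x1) in H1.
  pose proof (dot_le_norm n (vsub v1 v2) (vsub x1 x2)) as CS.
  rewrite dot_sub_l, !dot_sub_r in CS.
  replace (1 / (2 * kappa)) with (/ kappa / 2) in H1, H2 by (field; lra).
  set (a := norm (vsub x1 x2)) in *; set (b := norm (vsub v1 v2)) in *.
  assert (Ha : 0 <= a) by apply norm_nonneg; assert (Hb : 0 <= b) by apply norm_nonneg.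
  assert (K : / kappa * (a * a) <= b * a) by lra.
  assert (K' : a * a <= kappa * b * a).
  { apply Rmult_le_compat_l with (r := kappa) in K; [|lra].
    rewrite <- Rmult_assoc, Rinv_r in K by lra; lra. }
  destruct Ha as [Ha|Ha]; [nra|rewrite <- Ha; nra].
Qed.

Lemma tilt_stability : tilt_stable f feas xbar kappa.
Proof.
  destruct C2_region as [r1 [Hr1 HC]].
  destruct strict_local_minimizer as [r2 [Hr2 Hstrict]].
  destruct uniform_growth as [r3 [Hr3 Hgrow]].
  set (gamma := Rmin (Rmin r1 r2) r3 / 2).
  assert (Hg : 0 < gamma /\ gamma < r1 /\ gamma < r2 /\ gamma < r3).
  { pose proof (Rmin_l (Rmin r1 r2) r3); pose proof (Rmin_r (Rmin r1 r2) r3).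
    pose proof (Rmin_l r1 r2); pose proof (Rmin_r r1 r2).
    pose proof (Rmin_glb_lt _ _ _ (Rmin_glb_lt _ _ _ Hr1 Hr2) Hr3); unfold gamma; lra. }
  clearbody gamma; destruct Hg as (Hg & Hg1 & Hg2 & Hg3).
  destruct (minimizers_interior gamma Hg) as [e0 [He0 Hint]].
  { intros z Hz; apply HC; lra. }
  { intros y Fy Hy Hne; apply Hstrict; [exact Fy|lra|exact Hne]. }
  set (eps := Rmin e0 r3).
  assert (Heps : 0 < eps) by now apply Rmin_glb_lt.
  assert (He1 : eps <= e0) by apply Rmin_l; assert (He2 : eps <= r3) by apply Rmin_r.
  clearbody eps.
  assert (Hex : forall v, exists x, Mgamma f feas xbar gamma v x).
  { intro v.
    destruct (feasible_ball_minimizer (fun z => f z - dot v z) r1 gamma HC ltac:(lra)) as [x [[Fx Hx] M]].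
    - intros z xk Hz Hxk; apply is_lim_seq_minus'.
      + apply (C2_near_lim n f df d2f z); [apply HC, Hz|exact Hxk].
      + apply is_lim_seq_dot; [apply vlim_const|exact Hxk].
    - exists x; repeat split; [exact Fx|exact Hx|]; intros y Fy Hy; apply M; auto. }
  assert (HG : forall v x y, norm v < eps -> Mgamma f feas xbar gamma v x -> x <> xbar ->
     feas y -> norm (vsub y xbar) <= gamma ->
     f x - dot v x + 1 / (2 * kappa) * (norm (vsub y x) * norm (vsub y x)) <= f y - dot v y).
  { intros v x y Hv Hx Hne Fy Hy.
    pose proof (Hint v x ltac:(lra) Hx) as Hxg; destruct Hx as (Fx & _ & M).
    apply Hgrow; try assumption; try lra.
    apply (local_min_frechet_normal n f feas x (df x) v 0 (gamma - norm (vsub x xbar)));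
      [exact Fx|apply (C2_near_here n f df d2f), HC; lra|lra|lra|].
    intros z Fz Hz; pose proof (norm_vsub_triangle n z x xbar).
    specialize (M z Fz ltac:(lra)); lra. }
  assert (Hk : 0 < 1 / (2 * kappa)) by (apply Rdiv_lt_0_compat; lra).
  assert (Huniq : forall v x y, norm v < eps -> Mgamma f feas xbar gamma v x ->
     Mgamma f feas xbar gamma v y -> y = x).
  (* Growth from one minimizer different from [xbar] excludes every other one; two minimizers equal
     to [xbar] coincide anyway. *)
  { assert (W : forall v x y, norm v < eps -> Mgamma f feas xbar gamma v x ->
       Mgamma f feas xbar gamma v y -> x <> xbar -> y = x).
    { intros v x y Hv Hx Hy Hne; apply NNPP; intro E.
      destruct Hy as (Fy & Hyg & My).
      pose proof (HG v x y Hv Hx Hne Fy Hyg) as P; destruct Hx as (Fx & Hxg & Mx).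
      specialize (My x Fx Hxg); pose proof (norm_vsub_pos n y x E) as Q.
      pose proof (Rmult_lt_0_compat _ _ Hk (Rmult_lt_0_compat _ _ Q Q)); lra. }
    intros v x y Hv Hx Hy; destruct (classic (x = xbar)) as [E|E]; [|now apply (W v)].
    destruct (classic (y = xbar)) as [E'|E']; [congruence|symmetry; now apply (W v)]. }
  assert (Hlip : forall v1 v2 x1 x2, norm v1 < eps -> norm v2 < eps ->
     Mgamma f feas xbar gamma v1 x1 -> Mgamma f feas xbar gamma v2 x2 ->
     x1 <> xbar -> x2 <> xbar -> norm (vsub x1 x2) <= kappa * norm (vsub v1 v2)).
  { intros v1 v2 x1 x2 Hv1 Hv2 H1 H2 N1 N2; apply growth_lipschitz; apply HG; try assumption;
      (apply H1 || apply H2). }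
  (* Growth is not known at [xbar] itself. On the segment from [v2] to [v1], let [mm] be the
     infimum of the parameters at which [xbar] becomes optimal: just below [mm] the previous
     Lipschitz estimate applies, and passing from there to [xbar] costs at most twice the step. *)
  assert (Hlip0 : forall v1 v2 x2, norm v1 < eps -> norm v2 < eps ->
     Mgamma f feas xbar gamma v1 xbar -> Mgamma f feas xbar gamma v2 x2 -> x2 <> xbar ->
     norm (vsub x2 xbar) <= kappa * norm (vsub v2 v1)).
  { intros v1 v2 x2 Hv1 Hv2 H1 H2 N2.
    set (w := fun s => vadd v2 (vscale s (vsub v1 v2))).
    assert (Hw0 : w 0 = v2)
      by (apply functional_extensionality; intro; unfold w, vadd, vscale, vsub; ring).
    assert (Hw1 : w 1 = v1)
      by (apply functional_extensionality; intro; unfold w, vadd, vscale, vsub; ring).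
    assert (Hwe : forall s, 0 <= s <= 1 -> norm (w s) < eps).
    { intros s Hs.
      assert (Z : forall z : vec n, vsub z vzero = z)
        by (intro z; apply functional_extensionality; intro; unfold vsub, vzero; ring).
      rewrite <- (Z (w s)); apply segment_near; rewrite ?Z; assumption. }
    set (D := norm (vsub v2 v1)).
    assert (Hwd : forall s s', s <= s' -> norm (vsub (w s) (w s')) = (s' - s) * D).
    { intros s s' Hs; replace (vsub (w s) (w s')) with (vscale (s' - s) (vsub v2 v1))
        by (apply functional_extensionality; intro; unfold w, vadd, vscale, vsub; ring).
      rewrite norm_scale, Rabs_right by lra; reflexivity. }
    assert (HD : 0 <= D) by apply norm_nonneg.
    destruct (is_inf_exists (fun s => 0 <= s <= 1 /\ Mgamma f feas xbar gamma (w s) xbar)) as [mm Hmm].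
    { exists 1; split; [lra|]; rewrite Hw1; exact H1. }
    { exists 0; intros s Hs; lra. }
    assert (Hm0 : 0 <= mm) by (apply (proj2 Hmm); intros s Hs; lra).
    assert (Hm1 : mm <= 1) by (apply (proj1 Hmm); split; [lra|rewrite Hw1; exact H1]).
    apply le_epsilon; intros e He.
    (* The last piece costs [2 kappa (s' - s) D] with [s' - s < 2 h], that is at most
       [4 kappa h D <= e]. *)
    set (h := e / (4 * kappa * (D + 1))).
    assert (Hh : 0 < h) by (apply Rdiv_lt_0_compat; [lra|nra]).
    assert (Ehe : 4 * kappa * (h * (D + 1)) = e) by (unfold h; field; split; lra).
    clearbody h.
    destruct (is_inf_approx _ _ _ Hmm Hh) as [s' [[Hs' M'] Hs'm]].
    pose proof (proj1 Hmm s' (conj Hs' M')) as Hms'.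
    (* If [mm = 0] there is nothing below it, but [s = 0] works: the unique minimizer for [w 0 = v2]
       is [x2 <> xbar]. *)
    assert (Hs : exists s, 0 <= s <= mm /\ mm - h < s /\ ~ Mgamma f feas xbar gamma (w s) xbar).
    { destruct (Rle_lt_or_eq_dec 0 mm Hm0) as [L|L].
      - exists (Rmax 0 (mm - h / 2)); pose proof (Rmax_l 0 (mm - h / 2)); pose proof (Rmax_r 0 (mm - h / 2)).
        assert (Rmax 0 (mm - h / 2) < mm) by (apply Rmax_lub_lt; lra).
        split; [lra|split; [lra|]]; intro M.
        assert (Hin : 0 <= Rmax 0 (mm - h / 2) <= 1) by lra.
        pose proof (proj1 Hmm _ (conj Hin M)); lra.
      - exists 0; split; [lra|split; [lra|]]; rewrite Hw0; intro M.
        apply N2; symmetry; now apply (Huniq v2). }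
    destruct Hs as [s [Hs [Hsm Ms]]].
    destruct (Hex (w s)) as [z Hz].
    assert (Nz : z <> xbar) by (intro E; rewrite E in Hz; contradiction).
    assert (A : norm (vsub x2 z) <= kappa * (s * D)).
    { replace (s * D) with (norm (vsub v2 (w s))).
      - apply (Hlip v2 (w s)); try assumption; apply Hwe; lra.
      - rewrite <- Hw0 at 1; rewrite Hwd by lra; ring. }
    (* At [xbar] only optimality for [w s'] is available, so a single growth term enters and the
       constant doubles. *)
    assert (B : norm (vsub z xbar) <= 2 * kappa * ((s' - s) * D)).
    { rewrite <- (Hwd s s') by lra.
      pose proof (HG (w s) z xbar (Hwe s ltac:(lra)) Hz Nz feas_xbar) as P.
      rewrite norm_vsub_diag in P; specialize (P ltac:(lra)).
      rewrite (norm_vsub_sym n xbar z) in P.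
      destruct M' as (_ & _ & M'); specialize (M' z (proj1 Hz) (proj1 (proj2 Hz))).
      pose proof (dot_le_norm n (vsub (w s) (w s')) (vsub z xbar)) as CS.
      rewrite dot_sub_l, !dot_sub_r in CS.
      pose proof (norm_vsub_pos n z xbar Nz) as Q.
      set (a := norm (vsub z xbar)) in *; set (b := norm (vsub (w s) (w s'))) in *.
      assert (K : 1 / (2 * kappa) * (a * a) <= b * a) by lra.
      apply Rmult_le_compat_l with (r := 2 * kappa) in K; [|lra].
      replace (2 * kappa * (1 / (2 * kappa) * (a * a))) with (a * a) in K by (field; lra).
      apply Rmult_le_reg_r with a; [exact Q|lra]. }
    pose proof (norm_vsub_triangle n x2 z xbar) as T.
    assert (kappa * (s * D) <= kappa * D) by (apply Rmult_le_compat_l; nra).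
    assert ((s' - s) * D <= 2 * h * D) by (apply Rmult_le_compat_r; lra).
    assert (2 * kappa * ((s' - s) * D) <= 2 * kappa * (2 * h * D)) by (apply Rmult_le_compat_l; lra).
    assert (0 < kappa * h) by nra.
    nra. }
  exists gamma; split; [exact Hg|split].
  - exists eps; split; [exact Heps|split].
    + intros v Hv; destruct (Hex v) as [x Hx]; exists x; split; [exact Hx|].
      intros y Hy; now apply (Huniq v).
    + intros v1 v2 x1 x2 Hv1 Hv2 H1 H2.
      destruct (classic (x1 = xbar)) as [E1|E1]; destruct (classic (x2 = xbar)) as [E2|E2].
      * rewrite E1, E2, norm_vsub_diag; pose proof (norm_nonneg n (vsub v1 v2)); nra.
      * rewrite E1 in *; rewrite norm_vsub_sym, (norm_vsub_sym n v1 v2); now apply Hlip0.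
      * rewrite E2 in *; now apply Hlip0.
      * now apply Hlip.
  - assert (H0 : Mgamma f feas xbar gamma vzero xbar).
    { split; [apply feas_xbar|split; [rewrite norm_vsub_diag; lra|]].
      intros y Fy Hy; rewrite !dot_zero_l.
      destruct (classic (y = xbar)) as [->|E]; [lra|].
      pose proof (Hstrict y Fy ltac:(lra) E); lra. }
    intro x; split; [|intros ->; exact H0].
    intro Hx; apply (Huniq vzero); [rewrite norm_zero; exact Heps|exact H0|exact Hx].
Qed.
End Tilt.

(** * The second-order cone program *)

Lemma quad_madd n (A B : mat n) u : quad (madd A B) u = quad A u + quad B u.
Proof.
  unfold quad; rewrite <- dot_add_l; f_equal; apply functional_extensionality; intro i.
  exact (dot_add_l n (A i) (B i) u).
Qed.

Lemma quad_sumF n N (H : Fin.t N -> mat n) (l : vec N) u :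
  quad (fun i j => sumF N (fun k => l k * H k i j)) u = sumF N (fun k => l k * quad (H k) u).
Proof.
  unfold quad.
  rewrite <- (dot_adj n N (fun k => matvec (H k) u) l u); f_equal.
  apply functional_extensionality; intro i; unfold matvec at 1.
  exact (dot_adj n N (fun k => H k i) l u).
Qed.

Lemma curv_qzero n m (Jg0 : vec n) (Jgr : Fin.t m -> vec n) l u :
  quad (curv qzero Jg0 Jgr l) u = 0.
Proof.
  unfold curv; destruct (excluded_middle_informative _) as [[_ H]|_]; [now contradiction H|].
  transitivity (dot vzero u); [|apply dot_zero_l].
  unfold quad; f_equal; apply functional_extensionality; intro i; exact (dot_zero_l n u).
Qed.

Lemma NQ_qzero m (l : R * vec m) : NQ qzero l <-> soc_polar (vcons (fst l) (snd l)).
Proof.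
  change (NQ qzero l <-> norm (snd l) <= - fst l); split.
  - intros [[_ [p [Hp ->]]]|[[H _]|[_ [H _]]]].
    + unfold inQ in Hp; simpl; lra.
    + simpl in H; rewrite norm_zero in H; lra.
    + now contradiction H.
  - intro H; left; split; [reflexivity|]; exists (- fst l, snd l); split; [exact H|].
    destruct l as [l0 lr]; unfold hatq; simpl; f_equal; ring.
Qed.

(** The infima in [MSCQ] exist; the one over feasible points is attained up to [e], and the one over
    the cone is at most its value at [q]. *)
Lemma MSCQ_approx n m (g : vec n -> R * vec m) xbar sigma :
  0 < sigma -> inQ (g xbar) -> MSCQ g xbar sigma ->
  exists r, 0 < r /\ forall z q e, norm (vsub z xbar) < r -> inQ q -> 0 < e ->
    exists y, inQ (g y) /\ norm (vsub z y) <= sigma * pnorm (psub (g z) q) + e.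
Proof.
  intros Hs Hxbar [r [Hr H]]; exists r; split; [exact Hr|]; intros z q e Hz Hq He.
  destruct (is_inf_exists (fun s => exists y, Gamma g y /\ s = norm (vsub z y))) as [dG HG].
  { exists (norm (vsub z xbar)), xbar; split; [exact Hxbar|reflexivity]. }
  { exists 0; intros s [y [_ ->]]; apply norm_nonneg. }
  destruct (is_inf_exists (fun s => exists p, inQ p /\ s = pnorm (psub (g z) p))) as [dQ HQ].
  { exists (pnorm (psub (g z) q)), q; split; [exact Hq|reflexivity]. }
  { exists 0; intros s [p [_ ->]]; apply sqrt_pos. }
  specialize (H z Hz dG dQ HG HQ).
  destruct (is_inf_approx _ _ _ HG He) as [s [[y [Hy ->]] Hlt]].
  exists y; split; [exact Hy|].
  assert (dQ <= pnorm (psub (g z) q)) by (apply (proj1 HQ); exists q; split; [exact Hq|reflexivity]).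
  nra.
Qed.

Theorem theorem4p6 (n m : nat) (Hn : (1 <= n)%nat) (Hm : (1 <= m)%nat)
  (f : vec n -> R) (df : vec n -> vec n) (d2f : vec n -> mat n)
  (g : vec n -> R * vec m)
  (dg0 : vec n -> vec n) (d2g0 : vec n -> mat n)
  (dgr : Fin.t m -> vec n -> vec n) (d2gr : Fin.t m -> vec n -> mat n)
  (xbar : vec n) (sigma kappa : R) :
  C2_near f df d2f xbar ->
  C2_near (fun x => fst (g x)) dg0 d2g0 xbar ->
  (forall i, C2_near (fun x => snd (g x) i) (dgr i) (d2gr i) xbar) ->
  g xbar = qzero ->
  limiting_normal (Gamma g) xbar (vopp (df xbar)) ->
  0 < sigma -> MSCQ g xbar sigma ->
  0 < kappa ->
  (forall l : R * vec m,
     (exists v, critical (Gamma g) xbar (vopp (df xbar)) v /\ norm v = 1 /\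
        DirLambda (g xbar) (dg0 xbar) (fun i => dgr i xbar)
                  (d2g0 xbar) (fun i => d2gr i xbar) (vopp (df xbar)) v l) ->
     forall u, norm u = 1 ->
       pdot l (Jg_apply (dg0 xbar) (fun i => dgr i xbar) u) = 0 ->
       fst l * (norm (fun i => dot (dgr i xbar) u) ^ 2 - (dot (dg0 xbar) u) ^ 2) = 0 ->
       quad (madd (d2f xbar) (hess_lag (d2g0 xbar) (fun i => d2gr i xbar) l)) u > 1 / kappa) ->
  tilt_stable f (Gamma g) xbar kappa.
Proof.
  intros Hf Hg0 Hgr Hgx Hstat Hsigma Hmscq Hkappa Hso.
  set (G := fun x => vcons (fst (g x)) (snd (g x))).
  set (DG := fun i x => Fin.caseS' i (fun _ => vec n) (dg0 x) (fun j => dgr j x)).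
  set (D2G := fun i x => Fin.caseS' i (fun _ => mat n) (d2g0 x) (fun j => d2gr j x)).
  assert (HL : forall l u, quad (hess_lag (d2g0 xbar) (fun i => d2gr i xbar) l) u
    = sumF (S m) (fun i => vcons (fst l) (snd l) i * quad (D2G i xbar) u)).
  { intros l u.
    exact (quad_sumF n (S m) (fun i => D2G i xbar) (vcons (fst l) (snd l)) u). }
  (* [soc (G y)] and [inQ (g y)] are convertible, so what is known about [Gamma g] carries over
     unchanged. *)
  change (tilt_stable f (fun y => soc (G y)) xbar kappa).
  apply (tilt_stability n m f df d2f G DG D2G xbar sigma kappa Hf).
  - intro i; pattern i; apply (Fin.caseS' i); [exact Hg0|exact Hgr].
  - unfold G; rewrite Hgx; apply vec_S_ext; reflexivity.
  - exact Hstat.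
  - exact Hsigma.
  - exact Hkappa.
  - destruct (MSCQ_approx n m g xbar sigma Hsigma) as [r [Hr H]]; [|exact Hmscq|].
    { rewrite Hgx; unfold inQ; simpl; rewrite norm_zero; lra. }
    exists r; split; [exact Hr|]; intros z q e Hz Hq He.
    exact (H z (q Fin.F1, tl q) e Hz Hq He).
  - intros l v u Hcrit Hv Hl El Hmax Hu Hlu HJ.
    set (l' := (l Fin.F1, tl l) : R * vec m).
    assert (Evec : vcons (fst l') (snd l') = l) by (apply vec_S_ext; reflexivity).
    assert (Hlag : forall w, quad (hess_lag (d2g0 xbar) (fun i => d2gr i xbar) l') w
      = sumF (S m) (fun i => l i * quad (D2G i xbar) w)) by (intro w; rewrite HL, Evec; reflexivity).
    assert (P : quad (madd (d2f xbar) (hess_lag (d2g0 xbar) (fun i => d2gr i xbar) l')) u > 1 / kappa).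
    { apply Hso; [|exact Hu| |].
      - exists v; split; [exact Hcrit|split; [exact Hv|]]; rewrite Hgx; split.
        + split; [apply NQ_qzero; rewrite Evec; exact Hl|].
          exact El.
        + intros mu [Hmu Emu]; rewrite !quad_madd, !curv_qzero, Hlag, HL.
          apply Rplus_le_compat_r, Hmax; [now apply NQ_qzero|exact Emu].
      - rewrite dot_adj in Hlu; exact Hlu.
      - rewrite <- Rsqr_pow2, <- Rsqr_pow2; unfold Rsqr; rewrite norm_sq; exact HJ. }
    rewrite quad_madd, Hlag in P; exact P.
Qed.
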